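(* Let $w$ be a word in the alphabet $\{1',1,2',2,\dots,n',n\}$. Then $w$ is ballot if and only if, for every $i=1,\dots,n-1$, the $i$-th lattice walk of $w$ ends on the $x$-axis (i.e. its endpoint has $y$-coordinate $0$).
   Context: Letters are ordered $1'<1<2'<2<\cdots$. A string is a finite sequence of letters. Two strings are equivalent if they differ only in whether, for some values of $i$, the first letter from $\{i',i\}$ occurring in the string is primed; a word is an equivalence class of strings, and its canonical form is the representative in which, for every $i$, the first letter from $\{i',i\}$ is unprimed. Lattice walk of a word in $\{1',1,2',2\}$: it starts at $(0,0)$ and reads the letters left to right, each letter giving a unit step. If the current point $(x,y)$ has $x>0$ and $y>0$, then $1'$ steps east $(+1,0)$, $1$ steps south $(0,-1)$, $2$ steps north $(0,+1)$, $2'$ steps west $(-1,0)$. If $x=0$ or $y=0$, then $1$ and $1'$ step east and $2$ and $2'$ step north. The $i$-th lattice walk of a word $w$ is the lattice walk of the subword of $w$ consisting of the letters in $\{i',i,(i+1)',i+1\}$, with $i',i,(i+1)',i+1$ read as $1',1,2',2$ respectively. Shifted tableaux: a strict partition is $\lambda=(\lambda_1>\cdots>\lambda_k>0)$; its shifted diagram has row $r$ occupying columns $r,\dots,r+\lambda_r-1$; skew shapes $\lambda/\mu$ are differences of such diagrams. A shifted semistandard tableau is a filling of a shifted skew shape by letters $1'<1<2'<2<\cdots$ with rows and columns weakly increasing, each unprimed letter at most once per column and each primed letter at most once per row; its reading word is the concatenation of its rows read left to right, from bottom row to top row. $\mathrm{rect}(w)$ is the (well-defined) shifted jeu de taquin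 rectification of any shifted semistandard tableau with reading word $w$. A word $w$ is ballot if, taking $w$ in canonical form, for each $i$ the $i$-th row of $\mathrm{rect}(w)$ contains only the letter $i$ (unprimed). *)

(* Defs.v *)
From mathcomp Require Import all_boot.
Set Implicit Arguments. Unset Strict Implicit. Unset Printing Implicit Defensive.

(* A letter is a pair (i, p) with i >= 1 its value and p = true iff primed:
   (i, true) is i', (i, false) is i.  Order 1' < 1 < 2' < 2 < ... via [key]. *)
Definition letter := (nat * bool)%type.
Definition key (a : letter) : nat := (2 * a.1) - a.2.
Definition valid_letter (a : letter) : bool := 0 < a.1.

Fixpoint canon_aux (seen : seq nat) (w : seq letter) : seq letter :=
  match w with
  | [::] => [::]
  | x :: w' => if x.1 \in seen then x :: canon_aux seen w'
               else (x.1, false) :: canon_aux (x.1 :: seen) w'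
  end.
Definition canon (w : seq letter) : seq letter := canon_aux [::] w.

(* step for a letter of {1',1,2',2}, encoded with value 1 or 2 *)
Definition walk_step (pt : nat * nat) (a : letter) : nat * nat :=
  let: (x, y) := pt in
  if (0 < x) && (0 < y) then
    match a with
    | (1, true)  => (x.+1, y)
    | (1, false) => (x, y.-1)
    | (_, false) => (x, y.+1)
    | (_, true)  => (x.-1, y)
    end
  else if a.1 == 1 then (x.+1, y) else (x, y.+1).

Definition walk_end (w : seq letter) : nat * nat := foldl walk_step (0, 0) w.

Definition sub_walk_word (i : nat) (w : seq letter) : seq letter :=
  [seq ((a.1 - i).+1, a.2) | a <- w & (a.1 == i) || (a.1 == i.+1)].

Definition ith_walk_end (i : nat) (w : seq letter) : nat * nat :=
  walk_end (sub_walk_word i w).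

(** * Shifted shapes (rows and columns 0-indexed) *)
Definition strict_part (l : seq nat) : bool :=
  sorted gtn l && all (fun x => 0 < x) l.

Definition inshape (l : seq nat) (r c : nat) : bool :=
  (r < size l) && (r <= c) && (c < r + nth 0 l r).

Definition contained (mu lam : seq nat) : bool :=
  (size mu <= size lam) && all (fun r => nth 0 mu r <= nth 0 lam r) (iota 0 (size mu)).

Record tableau := Tableau {
  outer : seq nat;
  inner : seq nat;
  ent : nat -> nat -> letter }.  (* filling, relevant only on lambda/mu *)

Definition inskew (T : tableau) (r c : nat) : bool :=
  inshape (outer T) r c && ~~ inshape (inner T) r c.

Definition semistandard (T : tableau) : Prop :=
  [/\ strict_part (outer T), strict_part (inner T), contained (inner T) (outer T)
   & (forall r c, inskew T r c -> valid_letter (ent T r c))] /\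
      (forall r c, inskew T r c -> inskew T r c.+1 ->
         key (ent T r c) <= key (ent T r c.+1) /\
         (ent T r c = ent T r c.+1 -> (ent T r c).2 = false)) /\
      (forall r c, inskew T r c -> inskew T r.+1 c ->
         key (ent T r c) <= key (ent T r.+1 c) /\
         (ent T r c = ent T r.+1 c -> (ent T r c).2 = true)).

Definition reading (T : tableau) : seq letter :=
  flatten [seq [seq ent T r c | c <- iota (r + nth 0 (inner T) r)
                                       (nth 0 (outer T) r - nth 0 (inner T) r)]
          | r <- rev (iota 0 (size (outer T)))].

Definition dec_row (l : seq nat) (r : nat) : seq nat :=
  [seq x <- set_nth 0 l r (nth 0 l r).-1 | 0 < x].

Definition upd (f : nat -> nat -> letter) (r c : nat) (a : letter) :=
  fun r' c' => if (r' == r) && (c' == c) then a else f r' c'.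

(* Sagan--Worley convention: an entry sliding onto the main diagonal
   becomes unprimed *)
Definition diagfix (r c : nat) (a : letter) : letter :=
  if r == c then (a.1, false) else a.

Fixpoint slide_hole (fuel : nat) (lam : seq nat) (f : nat -> nat -> letter)
    (r c : nat) : seq nat * (nat -> nat -> letter) :=
  match fuel with
  | 0 => (lam, f)
  | k.+1 =>
    let inR := inshape lam r c.+1 in
    let inB := inshape lam r.+1 c in
    if inR || inB then
      let a := f r c.+1 in
      let b := f r.+1 c in
      let up := if inR && inB
                then (key b < key a) || ((key a == key b) && ~~ b.2)
                else inB in
      if up then slide_hole k lam (upd f r c (diagfix r c b)) r.+1 c
      else slide_hole k lam (upd f r c (diagfix r c a)) r c.+1
    else (dec_row lam r, f)
  end.

Definition inner_corner (mu : seq nat) (r : nat) : bool :=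
  (r < size mu) && (0 < nth 0 mu r) &&
  ((nth 0 mu r.+1 < (nth 0 mu r).-1) || (r.+1 == size mu)).

Definition slide_at (T : tableau) (r : nat) : tableau :=
  let c := r + (nth 0 (inner T) r).-1 in
  let res := slide_hole (sumn (outer T)).+1 (outer T) (ent T) r c in
  Tableau res.1 (dec_row (inner T) r) res.2.

Inductive rectifies : tableau -> tableau -> Prop :=
| rect_done T : inner T = [::] -> rectifies T T
| rect_step T r R : inner_corner (inner T) r ->
    rectifies (slide_at T r) R -> rectifies T R.

(* w is ballot iff (taking w in canonical form) the i-th row of rect(w)
   contains only the letter i (unprimed).  Row r (0-indexed) is row r+1. *)
Definition ballot (w : seq letter) : Prop :=
  forall T R, semistandard T -> reading T = canon w -> rectifies T R ->
    forall r c, inshape (outer R) r c -> ent R r c = (r.+1, false).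

(* Main.v *)
Require Import Defs.
From mathcomp Require Import all_boot zify.
Set Implicit Arguments. Unset Strict Implicit. Unset Printing Implicit Defensive.

(** Sliding a letter horizontally does not change the reading word, and sliding
    a letter b up from row r+1 to row r replaces A b B C D by A B C b D, where
    A b B is row r+1 and C D is row r with its hole.  Restricted to the letters
    of the i-th walk, a row has the form 1'^a 1^p 2'^e 2^q with a, e <= 1, and
    the row and column conditions bound the exponents of B by those of D and
    those of C by those of A; with these bounds both words move a point of the
    walk to the same endpoint.  Hence the endpoints are invariant under
    rectification.  For a straight tableau, the walks end on the x-axis when row
    r contains only the letter r.  Conversely, let j be the smallest value that
    occurs outside row j: after such an occurrence no letter of value j-1 is read,
    so the (j-1)-st walk ends strictly above the x-axis. *)

(** * Letters and lattice walks *)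

(** The diagonal is the obstacle. Away from it, each cell of C has a cell of A below it, which gives
    the bounds; the diagonal cell of row r has none, so C may hold one letter too many, and a letter
    sliding onto the diagonal loses its prime. What repairs both is the starting point of the walk.
    The rows below a diagonal cell carry larger values, so its letter is the first of its value to
    be read: the walk is then still on an axis, where primes are irrelevant, and in the critical
    case at the origin, where the surplus letter is absorbed. For the same reason the canonical form
    of the word leaves every diagonal letter unprimed. If i' slides onto the diagonal while the next
    diagonal letter is i, two consecutive diagonal entries share a value and the invariant on
    fillings breaks. The next move of the hole is then forced to be upward, and the two moves are
    treated as one. Since [ballot] speaks of all tableaux with the given reading word and all their
    rectifications, one direction has to produce such a tableau and a rectification of it. *)

Definition rowlt (x y : letter) : bool := (x.1 < y.1) || ((x.1 == y.1) && ~~ y.2).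
(** Each relation sees only one prime: [rowlt] that of its right argument, [collt] that of its upper
    argument. Changing the other prime is harmless. *)
Definition collt (x y : letter) : bool := (x.1 < y.1) || ((x.1 == y.1) && x.2).

(** The right-hand side is the test by which [slide_hole] decides to move the lower letter up. *)
Lemma rowltE (x y : letter) : valid_letter x -> valid_letter y ->
  rowlt x y = (key x < key y) || ((key y == key x) && ~~ x.2).
Proof. by case: x y => [a [|]] [b [|]]; rewrite /valid_letter /rowlt /key /=; lia. Qed.

(** When the test of [slide_hole] fails, the letter to the right may therefore stand above the lower
    one. *)
Lemma colltE (x y : letter) : valid_letter x -> valid_letter y ->
  collt x y = ~~ rowlt y x.
Proof. by case: x y => [a [|]] [b [|]]; rewrite /valid_letter /rowlt /collt /=; lia. Qed.

Lemma rowltP (x y : letter) : valid_letter x -> valid_letter y ->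
  rowlt x y <-> key x <= key y /\ (x = y -> x.2 = false).
Proof.
move=> vx vy; rewrite rowltE //; case: x y vx vy => [a p] [b q].
rewrite /valid_letter /key /= => vx vy; split.
  by case: p q => [] []; split => //; try lia; case=> *; lia.
by case: p q => [] [] [le h]; try lia; case: (eqVneq a b) => [e|]; 
  [have := h (congr1 (pair^~ _) e)|lia].
Qed.

Lemma collt_semistandard (x y : letter) : valid_letter x -> valid_letter y ->
  collt x y <-> key x <= key y /\ (x = y -> x.2 = true).
Proof.
move=> vx vy; case: x y vx vy => [a p] [b q].
rewrite /valid_letter /collt /key /= => vx vy; split.
  by case: p q => [] []; split => //; try lia; case=> *; lia.
by case: p q => [] [] [le h]; try lia; case: (eqVneq a b) => [e|]; 
  [have := h (congr1 (pair^~ _) e)|lia].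
Qed.

Lemma rowlt_trans : transitive rowlt.
Proof. by move=> [b q] [a p] [c s]; rewrite /rowlt /=; case: q s => [] []; lia. Qed.

Lemma collt_trans : transitive collt.
Proof. by move=> [b q] [a p] [c s]; rewrite /collt /=; case: p q => [] []; lia. Qed.

(** The middle letter cannot share its value with both others: with [x] it would be unprimed, with
    [z] primed. *)
Lemma rowlt_collt (x y z : letter) : rowlt x y -> collt y z -> x.1 < z.1.
Proof. by rewrite /rowlt /collt; case: (y.2); lia. Qed.

Lemma collt_rowlt (x y z : letter) : collt x y -> rowlt y z -> rowlt x z.
Proof. by rewrite /rowlt /collt; case: (z.2) (x.2) => [] []; lia. Qed.

(** An arbitrary starting point makes concatenation of words a composition of actions. *)
Definition act (i : nat) (w : seq letter) (pt : nat * nat) : nat * nat :=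
  foldl walk_step pt (sub_walk_word i w).

Lemma act_cat i u v pt : act i (u ++ v) pt = act i v (act i u pt).
Proof. by rewrite /act /sub_walk_word filter_cat map_cat foldl_cat. Qed.

Lemma act_cons i x v pt : act i (x :: v) pt = act i v (act i [:: x] pt).
Proof. by rewrite -cat1s act_cat. Qed.

Lemma act1 i (x : letter) pt : act i [:: x] pt =
  if x.1 == i then walk_step pt (1, x.2)
  else if x.1 == i.+1 then walk_step pt (2, x.2) else pt.
Proof.
case: x => a p; rewrite /act /sub_walk_word /=.
case: (eqVneq a i) => [->|ne] /=; first by rewrite subnn.
by case: (eqVneq a i.+1) => [->|ne'] //=; rewrite subSnn.
Qed.

Lemma act_skip i w pt : (forall x : letter, x \in w -> x.1 != i) -> 
  (forall x : letter, x \in w -> x.1 != i.+1) -> act i w pt = pt.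
Proof.
elim: w => // x w IH h1 h2; rewrite act_cons act1.
rewrite (negPf (h1 x _)) ?inE ?eqxx // (negPf (h2 x _)) ?inE ?eqxx //.
by apply: IH => y yw; [apply: h1|apply: h2]; rewrite inE yw orbT.
Qed.


(** * Closed forms for runs of equal letters *)

Definition east p (pt : nat * nat) := (pt.1 + p, pt.2).
Definition north p (pt : nat * nat) := (pt.1, pt.2 + p).
(** From x = 0 the first 1 steps east and only p - 1 letters descend. Truncated subtraction sends
    the steps left over at y = 0 to the east. *)
Definition walk1 p (pt : nat * nat) :=
  if pt.1 == 0 then if p == 0 then pt else ((p.-1 - pt.2).+1, pt.2 - p.-1)
  else (pt.1 + (p - pt.2), pt.2 - p).
(** A single 2' if e > 0; this suffices because a row contains 2' at most once. *)
Definition walk2p e (pt : nat * nat) :=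
  if e == 0 then pt else
  if (0 < pt.1) && (0 < pt.2) then (pt.1.-1, pt.2) else (pt.1, pt.2.+1).

Lemma foldl_walk1p p pt : foldl walk_step pt (nseq p (1, true)) = east p pt.
Proof.
elim: p pt => [|p IH] [x y] /=; first by rewrite /east addn0.
by rewrite IH; case: x y => [|x] [|y] //; rewrite /east /= addSnnS.
Qed.

Lemma foldl_walk2 p pt : foldl walk_step pt (nseq p (2, false)) = north p pt.
Proof.
elim: p pt => [|p IH] [x y] /=; first by rewrite /north addn0.
by rewrite IH; case: x y => [|x] [|y] //; rewrite /north /= addSnnS.
Qed.

Lemma foldl_walk1 p pt : foldl walk_step pt (nseq p (1, false)) = walk1 p pt.
Proof.
have pos q x y : foldl walk_step (x.+1, y) (nseq q (1, false)) =
    (x.+1 + (q - y), y - q).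
  elim: q x y => [|q IH] x [|y] //=; rewrite ?subn0 ?addn0 // IH;
    by congr (_, _); lia.
by case: pt p => [[|x] y] [|p] //; rewrite ?pos //= pos /walk1 /=.
Qed.

Lemma foldl_walk2p e pt : e <= 1 ->
  foldl walk_step pt (nseq e (2, true)) = walk2p e pt.
Proof. by case: pt e => x y [|[]]. Qed.

(** * Exchange identities for endpoints *)

Ltac split_ifs := repeat match goal with |- context [if ?b then _ else _] =>
    lazymatch b with context [if _ then _ else _] => fail
    | _ => case: (boolP b) => /= ? end end.
Ltac destruct_le1 := repeat match goal with
  | H : is_true (?n <= 1) |- _ => is_var n; destruct n as [|[|?]]; [clear H|clear H|by []] end.
Ltac walk_cases := destruct_le1; rewrite /walk1 /walk2p /east /north /=;
  repeat match goal with |- context [if ?b then _ else _] =>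
    lazymatch b with context [if _ then _ else _] => fail
    | _ => case: (boolP b) => /= ?; try (exfalso; lia) end end;
  congr (_, _); lia.

(* e, d and g count the 2' or 1' of one row, hence are at most 1. *)
Lemma walk_up1p e q p d q' pt : e <= 1 -> d <= 1 -> e + q <= p + d ->
  north q' (walk2p d (walk1 p (north q (walk2p e (east 1 pt))))) =
  north q' (walk2p d (walk1 p (east 1 (north q (walk2p e pt))))).
Proof. case: pt => x y e1 d1 le; congr (north _ _); walk_cases. Qed.

(** Just before D the two points are equal or differ by (1,1); in the latter case the lower one has
    x = 0 or y < e + q. Such points move in parallel along the 1s while the lower one is off the
    axes, and the first 1 or 2' read when it is on an axis makes them coincide. The bound e + q <= p
    + d guarantees that D contains this letter. The same argument covers the case where the moving
    letter is 1'. *)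
Lemma walk_up1 a m g e q p d q' pt : g <= 1 -> e <= 1 -> d <= 1 ->
    g <= a + m -> e + q <= p + d ->
  north q' (walk2p d (walk1 p (east g (north q (walk2p e (walk1 1
    (walk1 m (east a pt)))))))) =
  north q' (walk2p d (walk1 p (walk1 1 (east g (north q (walk2p e
    (walk1 m (east a pt)))))))).
Proof.
move=> g1 e1 d1 ga le; congr (north _ _).
(* If C has a 1', then A has a 1 or 1', and reading it has made x positive. *)
have: g <= (walk1 m (east a pt)).1.
  by case: pt => x y; rewrite /walk1 /east /=; split_ifs; lia.
case: (walk1 m (east a pt)) => [[|x] [|[|y]]] /= gx; destruct_le1; move: gx => //= _;
  rewrite /walk1 /walk2p /east /north /= ?addn0 ?addn1 ?subn0 /=; walk_cases.
Qed.

Lemma walk_up2p a m g q' pt : g <= 1 -> g <= a + m ->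
  north q' (east g (walk2p 1 (walk1 m (east a pt)))) =
  north q' (walk2p 1 (east g (walk1 m (east a pt)))).
Proof.
move=> g1 ga; congr (north _ _).
have: g <= (walk1 m (east a pt)).1.
  by case: pt => x y; rewrite /walk1 /east /=; split_ifs; lia.
case: (walk1 m (east a pt)) => x y /= gx; walk_cases.
Qed.

(** After A the height is at least e + q, hence at least k + d. So every 1 and 2' of C is read at
    positive height in both words, and the two paths stay one unit north of each other. *)
Lemma walk_up2 a m e q g k d pt : e <= 1 -> d <= 1 -> k + d <= e + q ->
  walk2p d (walk1 k (east g (north 1 (north q (walk2p e (walk1 m (east a pt))))))) =
  north 1 (walk2p d (walk1 k (east g (north q (walk2p e (walk1 m (east a pt))))))).
Proof.
move=> e1 d1 le; case: (walk1 m (east a pt)) => x y; walk_cases.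
Qed.

(* The walk starts at the origin here: rows below a diagonal 1 followed by a
   diagonal 2 contain neither of the two values. *)
Lemma walk_up2_diag e q k d : e <= 1 -> d <= 1 -> 0 < k -> k + d <= (e + q).+1 ->
  walk2p d (walk1 k (north 1 (north q (walk2p e (0, 0))))) =
  north 1 (walk2p d (walk1 k (north q (walk2p e (0, 0))))).
Proof. move=> e1 d1 k0 le; walk_cases. Qed.

(** If y > 0, the 2' steps west in one word and north in the other, and the points agree before D.
    If y = 0, they are equal or differ by (1,1), with the lower one at height e + q - 1, and merge
    within D. *)
Lemma walk_diag1 e q p d q' y : e <= 1 -> d <= 1 -> e + q <= p + d ->
    (0 < y -> 0 < e) ->
  north q' (walk2p d (walk1 p (east 1 (north q (walk2p e (walk1 1 (0, y))))))) =
  north q' (walk2p d (walk1 p (walk1 2 (north q (walk2p e (0, y)))))).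
Proof. move=> e1 d1 le ye; congr (north _ _); walk_cases. Qed.

(** * Walks along a row *)

Lemma sub_walk_word_cons i x v : sub_walk_word i (x :: v) =
  if x.1 == i then (1, x.2) :: sub_walk_word i v else
  if x.1 == i.+1 then (2, x.2) :: sub_walk_word i v else sub_walk_word i v.
Proof.
case: x => a p; rewrite /sub_walk_word /=.
case: (eqVneq a i) => [->|ne] /=; first by rewrite subnn.
by case: (eqVneq a i.+1) => [->|ne'] //=; rewrite subSnn.
Qed.

Lemma count_rowlt0 x y w : ~~ rowlt x y -> all (rowlt x) w -> count_mem y w = 0.
Proof.
move=> nxy /allP h; apply/count_memPn; apply/negP => /h.
by rewrite (negPf nxy).
Qed.

Lemma count_primed_le1 i w : pairwise rowlt w -> count_mem (i, true) w <= 1.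
Proof.
elim: w => //= x w IH /andP[h pw]; case: eqP => [e|_]; last exact: IH.
by rewrite (count_rowlt0 _ h) // e /rowlt /=; lia.
Qed.

Lemma sub_walk_sorted i w : pairwise rowlt w -> sub_walk_word i w =
  nseq (count_mem (i, true) w) (1, true) ++ nseq (count_mem (i, false) w) (1, false) ++
  nseq (count_mem (i.+1, true) w) (2, true) ++ nseq (count_mem (i.+1, false) w) (2, false).
Proof.
elim: w => //= x w IH /andP[h pw]; rewrite sub_walk_word_cons IH //.
case: (eqVneq x.1 i) => [e|ne].
  case: x e h => _ [|] /= -> h; rewrite !xpair_eqE !eqxx /= ltn_eqF //=.
  have z y : ~~ rowlt (i, false) y -> count_mem y w = 0 by move/count_rowlt0; apply.
  by rewrite (z (i, true)) // /rowlt /=; lia.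
case: (eqVneq x.1 i.+1) => [e|ne'].
  have z y : ~~ rowlt x y -> count_mem y w = 0 by move/count_rowlt0; apply.
  case: x e h z {ne} => _ [|] /= -> h z; rewrite !xpair_eqE !eqxx /= gtn_eqF //=;
  rewrite (z (i, true)) ?(z (i, false)) /rowlt //=; try lia.
  by rewrite (z (i.+1, true)) // /rowlt /=; lia.
by case: x ne ne' {h} => a b /= /negPf ne /negPf ne'; rewrite !xpair_eqE ne ne'.
Qed.

Lemma act_sorted i w pt : pairwise rowlt w -> act i w pt =
  north (count_mem (i.+1, false) w) (walk2p (count_mem (i.+1, true) w)
    (walk1 (count_mem (i, false) w) (east (count_mem (i, true) w) pt))).
Proof.
move=> h; rewrite /act sub_walk_sorted // !foldl_cat.
by rewrite foldl_walk1p foldl_walk1 foldl_walk2p ?count_primed_le1 // foldl_walk2.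
Qed.

Lemma east0 pt : east 0 pt = pt. Proof. by case: pt => x y; rewrite /east addn0. Qed.
Lemma north0 pt : north 0 pt = pt. Proof. by case: pt => x y; rewrite /north addn0. Qed.
Lemma walk10 pt : walk1 0 pt = pt.
Proof. by case: pt => x y; rewrite /walk1 /= addn0 subn0; case: ifP. Qed.
Lemma walk2p0 pt : walk2p 0 pt = pt. Proof. by []. Qed.
Definition walk0 := (east0, north0, walk10, walk2p0).

Definition rowseg (P : nat -> nat -> bool) (f : nat -> nat -> letter) s r :=
  [seq f r c | c <- s & P r c].

Lemma count_rowseg (P : nat -> nat -> bool) (f : nat -> nat -> letter) s r x :
  count_mem x (rowseg P f s r) = count (fun c => (f r c == x) && P r c) s.
Proof. by rewrite count_map count_filter; apply: eq_count. Qed.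

Lemma count_rowseg0 (P : nat -> nat -> bool) (f : nat -> nat -> letter) s r x :
    (forall c, c \in s -> P r c -> f r c <> x) ->
  count_mem x (rowseg P f s r) = 0.
Proof.
move=> h; rewrite count_rowseg; apply/eqP; rewrite -leqn0 leqNgt -has_count.
by apply/hasPn => c cs; apply/negP => /andP[/eqP e p]; apply: (h c cs p e).
Qed.

(** A sum of two exponents becomes one count over columns, so a bound between two rows reduces to an
    implication column by column. *)
Lemma count_rowseg2 (P : nat -> nat -> bool) (f : nat -> nat -> letter) s r x y : x != y ->
  count_mem x (rowseg P f s r) + count_mem y (rowseg P f s r) =
  count (fun c => ((f r c == x) || (f r c == y)) && P r c) s.
Proof.
move=> ne; rewrite !count_rowseg -count_predUI.
rewrite -[RHS]addn0; congr (_ + _).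
  by apply: eq_count => c /=; rewrite andb_orl.
rewrite -(count_pred0 s); apply: eq_count => c /=.
by case: eqP => [->|]; rewrite //= (negPf ne) andbF.
Qed.

Lemma leq_count_in (T : eqType) (p q : pred T) s :
  {in s, forall x, p x -> q x} -> count p s <= count q s.
Proof.
elim: s => //= x s IH h; apply: leq_add; last first.
  by apply: IH => y ys; apply: h; rewrite inE ys orbT.
by case px: (p x); rewrite // (h x _ px) // inE eqxx.
Qed.

(** * Moving a letter up *)

(* Semistandard on the occupied cells P, with unprimed diagonal.  [good_diag_lt]
   follows from the first two fields unless the cell (r, s) is the hole. *)
Record good (P : nat -> nat -> bool) (f : nat -> nat -> letter) : Prop := Good {
  good_row : forall r c1 c2, P r c1 -> P r c2 -> c1 < c2 -> rowlt (f r c1) (f r c2);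
  good_col : forall c r1 r2, P r1 c -> P r2 c -> r1 < r2 -> collt (f r1 c) (f r2 c);
  good_diag : forall r, P r r -> (f r r).2 = false;
  good_diag_lt : forall r s, P r r -> P s s -> r < s -> (f r r).1 < (f s s).1;
  good_valid : forall r c, P r c -> valid_letter (f r c) }.

(** The part of being a skew shifted shape that the slides rely on; intervals are filled only on and
    above the diagonal. *)
Record region (S : nat -> nat -> bool) : Prop := Region {
  region_le : forall r c, S r c -> r <= c;
  region_convex : forall r c r' c' r'' c'', S r c -> S r' c' ->
    r <= r'' <= r' -> c <= c'' <= c' -> r'' <= c'' -> S r'' c'' }.

Definition puncture (S : nat -> nat -> bool) r c : nat -> nat -> bool :=
  fun r' c' => S r' c' && ~~ ((r' == r) && (c' == c)).

Lemma act1_step i p pt :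
  (act i [:: (i, p)] pt = if p then east 1 pt else walk1 1 pt) /\
  (act i [:: (i.+1, p)] pt = if p then walk2p 1 pt else north 1 pt).
Proof.
have ne : (i.+1 == i) = false by lia.
split; rewrite act1 [fst _]/= ?ne eqxx [snd _]/=; case: p.
- exact: (foldl_walk1p 1 pt).
- exact: (foldl_walk1 1 pt).
- exact: (@foldl_walk2p 1 pt isT).
- exact: (foldl_walk2 1 pt).
Qed.

Lemma pairwise_rowseg (P : nat -> nat -> bool) (f : nat -> nat -> letter) r c m :
    (forall c1 c2, P r c1 -> P r c2 -> c1 < c2 -> rowlt (f r c1) (f r c2)) ->
  pairwise rowlt (rowseg P f (iota c m) r).
Proof.
move=> h; rewrite pairwise_map.
have : pairwise ltn [seq c' <- iota c m | P r c'].
  by rewrite pairwise_filter // -sorted_pairwise ?iota_ltn_sorted //; exact: ltn_trans.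
apply: (sub_in_pairwise (P := P r)); last exact: filter_all.
by move=> x y px py /=; apply: h.
Qed.

(* [lia] on the arithmetic hypotheses only: the others make it very slow. *)
Ltac qlia := try assumption; repeat match goal with
  | H : is_true (leq _ _) |- _ => revert H
  | H : is_true (_ && _) |- _ => revert H
  | H : is_true (_ || _) |- _ => revert H
  | H : is_true (~~ _) |- _ => revert H
  | H : is_true (_ == _) |- _ => revert H
  | H : @eq ?T _ _ |- _ => unify T nat; revert H
  | H : @eq bool _ _ |- _ => revert H end; clear; lia.

Section UpMove.
Variables (S : nat -> nat -> bool) (f : nat -> nat -> letter) (r c m i : nat).
Hypotheses (regS : region S) (Src : S r c) (Sbc : S r.+1 c).
Hypothesis gd : good (puncture S r c) f.
Hypothesis bD : forall c', c < c' -> S r c' -> rowlt (f r.+1 c) (f r c').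
Let b := f r.+1 c.
Let A := rowseg S f (iota 0 c) r.+1.
Let B := rowseg S f (iota c.+1 m) r.+1.
Let C := rowseg S f (iota 0 c) r.
Let D := rowseg S f (iota c.+1 m) r.

Let lt_rc : r < c. Proof. exact: region_le regS _ _ Sbc. Qed.

Lemma punctureE r' c' : S r' c' -> (r' != r) || (c' != c) -> puncture S r c r' c'.
Proof. by rewrite /puncture => ->; qlia. Qed.

Let rowS r' c1 c2 : S r' c1 -> S r' c2 -> c1 < c2 ->
  (r' != r) || (c1 != c) && (c2 != c) -> rowlt (f r' c1) (f r' c2).
Proof.
move=> s1 s2 lt h; apply: (good_row gd) => //; apply: punctureE => //; qlia.
Qed.
Let colS c' r1 r2 : S r1 c' -> S r2 c' -> r1 < r2 ->
  (c' != c) || (r1 != r) && (r2 != r) -> collt (f r1 c') (f r2 c').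
Proof.
move=> s1 s2 lt h; apply: (good_col gd) => //; apply: punctureE => //; qlia.
Qed.
Let diagS r' : S r' r' -> (f r' r').2 = false.
Proof. by move=> s; apply: (good_diag gd); apply: punctureE => //; qlia. Qed.
Let diagltS r' s : S r' r' -> S s s -> r' < s -> (f r' r').1 < (f s s).1.
Proof. by move=> s1 s2 lt; apply: (good_diag_lt gd) => //; apply: punctureE => //; qlia. Qed.

Let leftA c' : S r.+1 c' -> c' < c -> rowlt (f r.+1 c') b.
Proof. by move=> s lt; apply: rowS => //; qlia. Qed.

Let leftC c' : S r c' -> r < c' -> c' < c ->
  S r.+1 c' /\ collt (f r c') (f r.+1 c').
Proof.
move=> s lt1 lt2; have s' : S r.+1 c'.
  by apply: (region_convex regS s Sbc); qlia.
by split=> //; apply: colS => //; qlia.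
Qed.

(** The diagonal cell has nothing below it, so its letter is compared with the next diagonal one. *)
Let leftCdiag : S r r -> [/\ S r.+1 r.+1, (f r r).2 = false,
  (f r r).1 < (f r.+1 r.+1).1, (f r.+1 r.+1).2 = false &
  (r.+1 = c) \/ (r.+1 < c /\ rowlt (f r.+1 r.+1) b)].
Proof.
move=> s; have s' : S r.+1 r.+1.
  by apply: (region_convex regS s Sbc); qlia.
split; [by []|exact: diagS|exact: diagltS|exact: diagS|].
case: (eqVneq r.+1 c) => [|ne]; [by left|right; split; first qlia].
by apply: leftA => //; qlia.
Qed.

(** The cell of D above a cell of B lies between it and b: first a row step, then a column step, so
    the value rises strictly. *)
Let rightB c' : S r.+1 c' -> c < c' ->
  [/\ S r c', rowlt b (f r c'), collt (f r c') (f r.+1 c') & b.1 < (f r.+1 c').1].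
Proof.
move=> s lt; have s' : S r c' by apply: (region_convex regS Src s); qlia.
have h1 : rowlt b (f r c') by apply: bD.
have h2 : collt (f r c') (f r.+1 c') by apply: colS => //; qlia.
by split=> //; apply: rowlt_collt h1 h2.
Qed.

Let pA : pairwise rowlt A. Proof. by apply: pairwise_rowseg => *; apply: rowS => //; qlia. Qed.
Let pB : pairwise rowlt B. Proof. by apply: pairwise_rowseg => *; apply: rowS => //; qlia. Qed.
Let pC : pairwise rowlt C.
Proof.
rewrite /C; have -> : rowseg S f (iota 0 c) r = rowseg (puncture S r c) f (iota 0 c) r.
  rewrite /rowseg; congr map; apply: eq_in_filter => c'; rewrite mem_iota /puncture => h.
  by case: (S r c') => //=; qlia.
by apply: pairwise_rowseg => *; apply: (good_row gd).
Qed.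
Let pD : pairwise rowlt D.
Proof.
rewrite /D; have -> : rowseg S f (iota c.+1 m) r = rowseg (puncture S r c) f (iota c.+1 m) r.
  rewrite /rowseg; congr map; apply: eq_in_filter => c'; rewrite mem_iota /puncture => h.
  by case: (S r c') => //=; qlia.
by apply: pairwise_rowseg => *; apply: (good_row gd).
Qed.

Let zA x : (forall c', c' < c -> S r.+1 c' -> f r.+1 c' <> x) -> count_mem x A = 0.
Proof. by move=> h; apply: count_rowseg0 => c'; rewrite mem_iota => *; apply: h; qlia. Qed.
Let zB x : (forall c', c < c' -> S r.+1 c' -> f r.+1 c' <> x) -> count_mem x B = 0.
Proof. by move=> h; apply: count_rowseg0 => c'; rewrite mem_iota => *; apply: h; qlia. Qed.
Let zC x : (forall c', c' < c -> S r c' -> f r c' <> x) -> count_mem x C = 0.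
Proof. by move=> h; apply: count_rowseg0 => c'; rewrite mem_iota => *; apply: h; qlia. Qed.
Let zD x : (forall c', c < c' -> S r c' -> f r c' <> x) -> count_mem x D = 0.
Proof. by move=> h; apply: count_rowseg0 => c'; rewrite mem_iota => *; apply: h; qlia. Qed.

(** A letter of D standing above an (i+1)' or i+1 of B and allowed to the right of b can only be i
    or (i+1)'. *)
Let bB_DS : b.1 = i ->
  count_mem (i.+1, true) B + count_mem (i.+1, false) B <=
  count_mem (i, false) D + count_mem (i.+1, true) D.
Proof.
move=> e; rewrite !count_rowseg2; [|by rewrite -pair_eqE /pair_eq /=; qlia..].
apply: leq_count_in => c'; rewrite mem_iota => cc' /andP[fx Sx].
have [|S' h1 h2 _] := rightB Sx; first by qlia.
rewrite S' andbT; move: h1 h2 fx; rewrite /rowlt /collt -!pair_eqE /pair_eq /= e.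
by case: (f r c') => u [|] /=; qlia.
Qed.

Let zB1 : i <= b.1 -> (count_mem (i, true) B = 0) * (count_mem (i, false) B = 0).
Proof.
move=> e; split; apply: zB => c' lt s E; have [_ _ _] := rightB s lt; rewrite E /=; qlia.
Qed.

(** With i, i+1 read as 1, 2, the segments reduce to A = 1'^a 1^m, B = 2'^e 2^q, C = 1'^g, D = 1^p
    2'^d 2^q', where g = 0 if b is primed. A diagonal letter of C has value below i and drops
    out. *)
Lemma up_move_act_i pt : b.1 = i ->
  act i (A ++ b :: B ++ C ++ D) pt = act i (A ++ B ++ C ++ b :: D) pt.
Proof.
move=> eb; have [bt bf] : (forall pt, b.2 = true -> act i [:: b] pt = east 1 pt) /\
    (forall pt, b.2 = false -> act i [:: b] pt = walk1 1 pt).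
  by split=> pt' h; rewrite [b]surjective_pairing eb h (proj1 (act1_step _ _ _)).
rewrite !(act_cat, act_cons i b (_ ++ _), act_cons i b D).
have Cle c' : S r c' -> c' < c -> i <= (f r c').1 ->
    [/\ S r.+1 c', collt (f r c') (f r.+1 c') & rowlt (f r.+1 c') b].
  move=> s lt le; case: (ltngtP r c') => [rc|rc|rc]; last 1 first.
  - subst c'; have [_ _ h1 _ [h2|[_ h2]]] := leftCdiag s.
      by move: eb h1 le; rewrite /b -h2; qlia.
    by move: h2 h1 le; rewrite /rowlt eb; qlia.
  - by have [s' h] := leftC s rc lt; split=> //; apply: leftA.
  - by have := region_le regS s; qlia.
have zC2 : (count_mem (i.+1, true) C = 0) * (count_mem (i.+1, false) C = 0).
  by split; apply: zC => c' lt s E; have [|_] := Cle _ s lt; rewrite E //= => h1 h2;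
    have := collt_rowlt h1 h2; rewrite /rowlt eb /=; qlia.
have zC1 : count_mem (i, false) C = 0.
  apply: zC => c' lt s E; have [|_] := Cle _ s lt; rewrite E //= => h1 h2.
  by have := rowlt_collt h2; move: h1 h2; rewrite /rowlt /collt eb /=; case: (b.2); qlia.
have zA2 : (count_mem (i.+1, true) A = 0) * (count_mem (i.+1, false) A = 0).
  by split; apply: zA => c' lt s E; have := leftA s lt; rewrite E /rowlt eb /=; qlia.
have zD1 : count_mem (i, true) D = 0.
  by apply: zD => c' lt s E; have := bD lt s; rewrite E /rowlt -/b eb /=; qlia.
have le1 x (w : seq letter) : pairwise rowlt w -> count_mem (x, true) w <= 1.
  exact: count_primed_le1.
have zB' := zB1 (eq_leq (esym eb)).
rewrite !(act_sorted i _ pA) !(act_sorted i _ pB) !(act_sorted i _ pC) !(act_sorted i _ pD).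
rewrite !zC1 !zC2 !zA2 !zD1 !zB' !walk0.
case eb2: b.2; [rewrite !bt //|rewrite !bf //].
  rewrite (zC (x := (i, true))); last first.
    move=> c' lt s E; have [|_] := Cle _ s lt; rewrite E //= => h1 h2.
    by have := collt_rowlt h1 h2; rewrite /rowlt eb eb2 /=; qlia.
  by rewrite !walk0; apply: walk_up1p; [exact: le1|exact: le1|exact: bB_DS].
apply: walk_up1; [exact: le1|exact: le1|exact: le1| |exact: bB_DS].
rewrite count_rowseg2; last by rewrite -pair_eqE /pair_eq /=; qlia.
rewrite count_rowseg.
apply: leq_count_in => c'; rewrite mem_iota => lt /andP[/eqP E s].
have [||s' h1 h2] := Cle _ s; [qlia|by rewrite E|rewrite s' andbT].
move: h1 h2; rewrite E /collt /rowlt eb eb2 -!pair_eqE /pair_eq /=.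
by case: (f r.+1 c') => u [|] /=; qlia.
Qed.

(** Here B drops out and D reduces to 2^q'. The condition on [pt] serves the case where the diagonal
    letters of rows r and r+1 are i and i+1, in which A does not account for all of C. *)
Lemma up_move_act_iS pt : b.1 = i.+1 ->
  (S r r -> (f r.+1 r.+1).1 = i.+1 -> pt = (0, 0)) ->
  act i (A ++ b :: B ++ C ++ D) pt = act i (A ++ B ++ C ++ b :: D) pt.
Proof.
move=> eb hpt; have [bt bf] : (forall pt, b.2 = true -> act i [:: b] pt = walk2p 1 pt) /\
    (forall pt, b.2 = false -> act i [:: b] pt = north 1 pt).
  by split=> pt' h; rewrite [b]surjective_pairing eb h (proj2 (act1_step _ _ _)).
rewrite !(act_cat, act_cons i b (_ ++ _), act_cons i b D).
have le1 x (w : seq letter) : pairwise rowlt w -> count_mem (x, true) w <= 1.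
  exact: count_primed_le1.
have zB' : (count_mem (i, true) B = 0) * (count_mem (i, false) B = 0).
  by apply: zB1; qlia.
have zB2 : (count_mem (i.+1, true) B = 0) * (count_mem (i.+1, false) B = 0).
  split; apply: zB => c' lt s E; have [_ _ _] := rightB s lt; rewrite E eb /=; qlia.
have zD1 : (count_mem (i, true) D = 0) * (count_mem (i, false) D = 0) * 
           (count_mem (i.+1, true) D = 0).
  by do !split; apply: zD => c' lt s E; have := bD lt s; rewrite E /rowlt -/b eb /=; qlia.
rewrite !(act_sorted i _ pA) !(act_sorted i _ pB) !(act_sorted i _ pC) !(act_sorted i _ pD).
rewrite !zB' !zB2 !zD1 !walk0.
case eb2: b.2; [rewrite !bt //|rewrite !bf //].
  have Cle c' : S r c' -> c' < c -> i <= (f r c').1 ->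
      [/\ S r.+1 c', collt (f r c') (f r.+1 c') & rowlt (f r.+1 c') b].
    move=> s lt le; case: (ltngtP r c') => [rc|rc|rc]; last 1 first.
    - subst c'; have [_ _ h1 h3 [h2|[_ h2]]] := leftCdiag s.
        by move: eb2 h3; rewrite /b -h2 => ->.
      by move: h2 h1 le; rewrite /rowlt eb eb2; qlia.
    - by have [s' h] := leftC s rc lt; split=> //; apply: leftA.
    - by have := region_le regS s; qlia.
  have zC2 : (count_mem (i.+1, true) C = 0) * (count_mem (i.+1, false) C = 0).
    by split; apply: zC => c' lt s E; have [|_] := Cle _ s lt; rewrite E //= => h1 h2;
      have := collt_rowlt h1 h2; rewrite /rowlt eb eb2 /=; qlia.
  have zC1 : count_mem (i, false) C = 0.
    apply: zC => c' lt s E; have [|_] := Cle _ s lt; rewrite E //=.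
    by rewrite /rowlt /collt eb eb2 /=; qlia.
  have zA2 : (count_mem (i.+1, true) A = 0) * (count_mem (i.+1, false) A = 0).
    by split; apply: zA => c' lt s E; have := leftA s lt; rewrite E /rowlt eb eb2 /=; qlia.
  rewrite !zC2 !zC1 !zA2 !walk0; apply: walk_up2p; first exact: le1.
  rewrite count_rowseg2; last by rewrite -pair_eqE /pair_eq /=; qlia.
  rewrite count_rowseg.
  apply: leq_count_in => c'; rewrite mem_iota => lt /andP[/eqP E s].
  have [||s' h1 h2] := Cle _ s; [qlia|by rewrite E|rewrite s' andbT].
  move: h1 h2; rewrite E /collt /rowlt eb eb2 -!pair_eqE /pair_eq /=.
  by case: (f r.+1 c') => u [|] /=; qlia.
have Cle c' : S r c' -> r < c' -> c' < c ->
    [/\ S r.+1 c', collt (f r c') (f r.+1 c') & rowlt (f r.+1 c') b].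
  by move=> s rc lt; have [s' h] := leftC s rc lt; split=> //; apply: leftA.
have zC2 : count_mem (i.+1, false) C = 0.
  apply: zC => c' lt s E; case: (ltngtP r c') => [rc|rc|rc].
  - by have [_] := Cle _ s rc lt; rewrite E /collt /rowlt eb eb2 /=; qlia.
  - by have := region_le regS s; qlia.
  - subst c'; have [_ _ h1 h3 [h2|[_ h2]]] := leftCdiag s.
      by move: eb h1; rewrite E /= /b -h2; qlia.
    by move: h2 h1; rewrite E /rowlt eb eb2 /=; qlia.
rewrite zC2 !walk0; congr (north _ _).
(* Any other i or (i+1)' of C stands above an (i+1)' or i+1 of A. *)
case Srr: (S r r && (i <= (f r r).1)); last first.
  apply: walk_up2; [exact: le1|exact: le1|].
  rewrite !count_rowseg2; [|by rewrite -pair_eqE /pair_eq /=; qlia..].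
  apply: leq_count_in => c'; rewrite mem_iota => lt /andP[E s].
  case: (ltngtP r c') => [rc|rc|rc].
  - have [|s' h1 h2] := Cle _ s rc; first qlia.
    move: h1 h2 E; rewrite s' /collt /rowlt eb eb2 -!pair_eqE /pair_eq /=.
    by case: (f r.+1 c') => u [|]; case: (f r c') => u' [|] /=; qlia.
  - by have := region_le regS s; qlia.
  - by subst c'; move: Srr E; rewrite s -!pair_eqE /pair_eq /=; qlia.
have {Srr} [srr le] := andP Srr.
have [s1 h0 h1 h3 h2] := leftCdiag srr.
have e1 : (f r r).1 = i.
  by case: h2 => [h2|[_ h2]]; [move: eb h1; rewrite /b -h2|move: h2 h1; rewrite /rowlt eb];
    qlia.
have e2 : (f r.+1 r.+1).1 = i.+1.
  by case: h2 => [h2|[_ h2]]; [move: eb h1; rewrite /b -h2|move: h2 h1; rewrite /rowlt eb];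
    qlia.
have frr : f r r = (i, false) by rewrite [f r r]surjective_pairing e1 h0.
rewrite (hpt srr e2).
have zA1 : (count_mem (i, true) A = 0) * (count_mem (i, false) A = 0).
  split; apply: zA => c' lt s E; have le' := region_le regS s;
  (case: (ltngtP r.+1 c') => [rc|rc|rc];
   [have : rowlt (f r.+1 r.+1) (f r.+1 c') by apply: rowS => //; qlia
   |qlia|by subst c'; move: e2; rewrite E /=; qlia]);
  by rewrite E /rowlt e2 /=; qlia.
have zC1 : count_mem (i, true) C = 0.
  apply: zC => c' lt s E; have le' := region_le regS s.
  case: (ltngtP r c') => [rc|rc|rc]; [|qlia|by subst c'; move: h0; rewrite E].
  have : rowlt (f r r) (f r c') by apply: (good_row gd) => //; apply: punctureE => //; qlia.
  by rewrite E frr /rowlt /=; qlia.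
rewrite !zA1 !zC1 !walk0.
have Ceq : iota 0 c = iota 0 r ++ r :: iota r.+1 (c - r.+1).
  by rewrite -{1}(subnKC lt_rc) iotaD -addn1 iotaD -catA.
(* The diagonal i has no partner in A, whence the extra unit in the bound. It is read at x = 0 and
   steps east without losing height. *)
apply: walk_up2_diag; [exact: le1|exact: le1| |].
  rewrite -has_count; apply/hasP; exists (f r r); last by rewrite /= frr.
  by apply: map_f; rewrite mem_filter srr mem_iota; qlia.
rewrite !count_rowseg2; [|by rewrite -pair_eqE /pair_eq /=; qlia..].
rewrite Ceq !count_cat /= srr frr eqxx /=.
rewrite (@eq_in_count _ _ pred0 (iota 0 r)); last first.
  move=> c'; rewrite mem_iota => lt /=; apply/negbTE/negP => /andP[_ s].
  by have := region_le regS s; qlia.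
rewrite count_pred0 add0n add1n ltnS.
apply: (@leq_trans (count (fun c0 =>
  ((f r.+1 c0 == (i.+1, true)) || (f r.+1 c0 == (i.+1, false))) && S r.+1 c0)
  (iota r.+1 (c - r.+1)))); last qlia.
apply: leq_count_in => c'; rewrite mem_iota => lt /andP[E s].
have [||s' h4 h5] := Cle _ s; [qlia|qlia|].
move: h4 h5 E; rewrite s' /collt /rowlt eb eb2 -!pair_eqE /pair_eq /=.
by case: (f r.+1 c') => u [|]; case: (f r c') => u' [|] /=; qlia.
Qed.

Lemma up_move_act pt :
  (S r r -> (f r.+1 r.+1).1 = i.+1 -> pt = (0, 0)) ->
  act i (A ++ b :: B ++ C ++ D) pt = act i (A ++ B ++ C ++ b :: D) pt.
Proof.
case: (eqVneq b.1 i) => [e _|ne]; first exact: up_move_act_i.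
case: (eqVneq b.1 i.+1) => [e|ne' _]; first exact: up_move_act_iS.
have skip pt' : act i [:: b] pt' = pt' by rewrite act1 (negPf ne) (negPf ne').
by rewrite !(act_cat, act_cons i b (_ ++ _), act_cons i b D) !skip.
Qed.

End UpMove.

(** * Slides preserve the row and column conditions *)

Lemma rowlt_diagfix r c x z : rowlt (diagfix r c x) z = rowlt x z.
Proof. by rewrite /rowlt /diagfix; case: ifP. Qed.
Lemma diagfix1 r c x : (diagfix r c x).1 = x.1.
Proof. by rewrite /diagfix; case: ifP. Qed.
Lemma diagfix_id r c x : r != c -> diagfix r c x = x.
Proof. by rewrite /diagfix => /negPf->. Qed.
Lemma collt_lt x z : x.1 < z.1 -> collt x z.
Proof. by rewrite /collt => ->. Qed.
Lemma upd_eq f r c a : upd f r c a r c = a.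
Proof. by rewrite /upd !eqxx. Qed.
Lemma upd_neq f r c a r' c' : (r' != r) || (c' != c) -> upd f r c a r' c' = f r' c'.
Proof. by rewrite /upd; case: eqP => //= _; case: eqP. Qed.

Section Moves.
Variables (S : nat -> nat -> bool).
Hypothesis regS : region S.

Lemma punctE r c r' c' : S r' c' -> (r' != r) || (c' != c) -> puncture S r c r' c'.
Proof. by rewrite /puncture => ->; clear; lia. Qed.

Lemma punctI r c r' c' : puncture S r c r' c' -> S r' c' /\ ((r' != r) || (c' != c)).
Proof. by rewrite /puncture => /andP[-> /= h]; split=> //; move: h; clear; lia. Qed.

(** The condition on the lower letter is the failed test of [slide_hole]; the last one excludes the
    exceptional slide, after which two diagonal entries would have the same value. *)
Lemma good_right_move r c f : S r c -> S r c.+1 -> good (puncture S r c) f ->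
    (S r.+1 c -> collt (f r c.+1) (f r.+1 c)) ->
    (r = c -> S r.+1 r.+1 -> (f r r.+1).1 < (f r.+1 r.+1).1) ->
  good (puncture S r c.+1) (upd f r c (diagfix r c (f r c.+1))).
Proof.
move=> s0 s1 g hb hd; have le_rc := region_le regS s0.
have pa : puncture S r c r c.+1 by apply: punctE => //; clear; lia.
have above r1 c1 : S r1 c1 -> c1 <= c -> r1 < r -> (f r1 c1).1 < (f r c.+1).1.
  move=> s lt1 lt2; have s' : S r1 c.+1.
    by have h := region_le regS s; apply: (region_convex regS s s1); qlia.
  apply: (@rowlt_collt _ (f r1 c.+1)); [apply: (good_row g) | apply: (good_col g)] => //;
    by [qlia|apply: punctE => //; qlia].
split.
- move=> r' c1 c2 /punctI[p1 n1] /punctI[p2 n2] lt.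
  case: (eqVneq r' r) => [e|ne]; last first.
    rewrite !upd_neq ?ne //; apply: (good_row g) => //; apply: punctE => //; qlia.
  subst r'; case: (eqVneq c1 c) => [e|ne1].
    subst c1; rewrite upd_eq upd_neq; last by qlia.
    rewrite rowlt_diagfix; apply: (good_row g) => //; first by apply: punctE => //; qlia.
    by qlia.
  case: (eqVneq c2 c) => [e|ne2].
    subst c2; rewrite upd_eq upd_neq; last by qlia.
    rewrite diagfix_id; last by have h := region_le regS p1; qlia.
    apply: (good_row g) => //; first by apply: punctE => //; qlia.
    by qlia.
  by rewrite !upd_neq ?ne1 ?ne2 ?orbT //; apply: (good_row g) => //; apply: punctE => //; qlia.
- move=> c' r1 r2 /punctI[p1 n1] /punctI[p2 n2] lt.
  case: (eqVneq c' c) => [e|ne]; last first.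
    rewrite !upd_neq ?ne ?orbT //; apply: (good_col g) => //; apply: punctE => //; qlia.
  subst c'; case: (eqVneq r1 r) => [e|ne1].
    subst r1; rewrite upd_eq upd_neq; last by qlia.
    have le2 := region_le regS p2.
    have s' : S r.+1 c by apply: (region_convex regS s0 p2); qlia.
    rewrite diagfix_id; last by qlia.
    case: (eqVneq r2 r.+1) => [->|ne2]; first exact: hb.
    apply: (collt_trans (hb s')); apply: (good_col g); try (apply: punctE => //); qlia.
  case: (eqVneq r2 r) => [e|ne2].
    subst r2; rewrite upd_eq upd_neq; last by qlia.
    by apply: collt_lt; rewrite diagfix1; apply: above => //; qlia.
  by rewrite !upd_neq ?ne1 ?ne2 //; apply: (good_col g) => //; apply: punctE => //; qlia.
- move=> r' /punctI[p n]; case: (boolP ((r' == r) && (r' == c))) => [/andP[/eqP e /eqP e']|ne].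
    by subst r' r; rewrite upd_eq /diagfix eqxx.
  by rewrite upd_neq; [apply: (good_diag g); apply: punctE => //; qlia|qlia].
- move=> r' s /punctI[p1 n1] /punctI[p2 n2] lt.
  case: (boolP ((r' == r) && (r' == c))) => [/andP[/eqP e /eqP e']|ne1].
    subst r' r; rewrite upd_eq upd_neq; last by qlia.
    rewrite diagfix1; case: (eqVneq s c.+1) => [e|ne]; first by subst s; apply: hd.
    have s' : S c s by apply: (region_convex regS s0 p2); qlia.
    apply: (@rowlt_collt _ (f c s)); [apply: (good_row g) | apply: (good_col g)] => //;
      by [qlia|apply: punctE => //; qlia].
  case: (boolP ((s == r) && (s == c))) => [/andP[/eqP e /eqP e']|ne2].
    subst s r; rewrite upd_eq upd_neq; last by qlia.
    by rewrite diagfix1; apply: above => //; qlia.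
  rewrite !upd_neq; [|qlia..].
  by apply: (good_diag_lt g) => //; apply: punctE => //; qlia.
- move=> r' c' /punctI[p n].
  case: (boolP ((r' == r) && (c' == c))) => [/andP[/eqP e /eqP e']|ne].
    by subst r' c'; rewrite upd_eq /valid_letter diagfix1; apply: (good_valid g).
  by rewrite upd_neq; [apply: (good_valid g); apply: punctE => //; qlia|qlia].
Qed.

(** No prime is dropped, since a hole with a cell below it is off the diagonal. Entries to the left
    in row r are compared with the moved letter through the cells below them. *)
Lemma good_up_move r c f : S r c -> S r.+1 c -> good (puncture S r c) f ->
    (forall c', c < c' -> S r c' -> rowlt (f r.+1 c) (f r c')) ->
  good (puncture S r.+1 c) (upd f r c (f r.+1 c)).
Proof.
move=> s0 s1 g bD; have lt_rc := region_le regS s1.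
have pb : puncture S r c r.+1 c by apply: punctE => //; clear; lia.
split.
- move=> r' c1 c2 /punctI[p1 n1] /punctI[p2 n2] lt.
  case: (eqVneq r' r) => [e|ne]; last first.
    rewrite !upd_neq ?ne //; apply: (good_row g) => //; apply: punctE => //; qlia.
  subst r'; case: (eqVneq c1 c) => [e|ne1].
    by subst c1; rewrite upd_eq upd_neq; [exact: bD|qlia].
  case: (eqVneq c2 c) => [e|ne2].
    subst c2; rewrite upd_eq upd_neq; last by qlia.
    have le1 := region_le regS p1.
    have s' c' : r < c' -> c1 <= c' -> c' <= c -> S r.+1 c'.
      by move=> *; apply: (region_convex regS p1 s1); qlia.
    (* The diagonal entry has no cell below it; the strict increase along the diagonal replaces the
       column step. *)
    case: (eqVneq c1 r) => [e|ne].
      subst c1; have s2 : S r.+1 r.+1 by apply: s'; qlia.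
      have h : (f r r).1 < (f r.+1 r.+1).1.
        by apply: (good_diag_lt g); try (apply: punctE => //); qlia.
      case: (eqVneq c r.+1) => [->|nec]; first by rewrite /rowlt h.
      have : rowlt (f r.+1 r.+1) (f r.+1 c).
        by apply: (good_row g); try (apply: punctE => //); qlia.
      by move: h; rewrite /rowlt; clear; lia.
    apply: (@collt_rowlt _ (f r.+1 c1)); [apply: (good_col g)|apply: (good_row g)] => //;
      by [qlia|apply: punctE; [by [|apply: s'; qlia]|qlia]].
  by rewrite !upd_neq ?ne1 ?ne2 ?orbT //; apply: (good_row g) => //; apply: punctE => //; qlia.
- move=> c' r1 r2 /punctI[p1 n1] /punctI[p2 n2] lt.
  case: (eqVneq c' c) => [e|ne]; last first.
    rewrite !upd_neq ?ne ?orbT //; apply: (good_col g) => //; apply: punctE => //; qlia.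
  subst c'; case: (eqVneq r1 r) => [e|ne1].
    subst r1; rewrite upd_eq upd_neq; last by qlia.
    by apply: (good_col g) => //; try (apply: punctE => //); qlia.
  case: (eqVneq r2 r) => [e|ne2].
    subst r2; rewrite upd_eq upd_neq; last by qlia.
    by apply: (good_col g) => //; try (apply: punctE => //); qlia.
  by rewrite !upd_neq ?ne1 ?ne2 //; apply: (good_col g) => //; apply: punctE => //; qlia.
- move=> r' /punctI[p n]; rewrite upd_neq; last by qlia.
  by apply: (good_diag g); apply: punctE => //; qlia.
- move=> r' s /punctI[p1 n1] /punctI[p2 n2] lt; rewrite !upd_neq; [|qlia..].
  by apply: (good_diag_lt g) => //; apply: punctE => //; qlia.
- move=> r' c' /punctI[p n].
  case: (boolP ((r' == r) && (c' == c))) => [/andP[/eqP e /eqP e']|ne].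
    by subst r' c'; rewrite upd_eq; apply: (good_valid g).
  by rewrite upd_neq; [apply: (good_valid g); apply: punctE => //; qlia|qlia].
Qed.

(* The exceptional slide: i' moves onto the diagonal, becomes i, and is
   followed by the i below it. *)
Lemma good_diag_move r f : S r r -> S r.+1 r.+1 -> good (puncture S r r) f ->
    (f r r.+1).1 = (f r.+1 r.+1).1 ->
  good (puncture S r.+1 r.+1)
    (upd (upd f r r (diagfix r r (f r r.+1))) r r.+1 (f r.+1 r.+1)).
Proof.
move=> s0 s2 g eab.
have s1 : S r r.+1 by apply: (region_convex regS s0 s2); lia.
have pb : puncture S r r r.+1 r.+1 by apply: punctE => //; clear; lia.
have pa : puncture S r r r r.+1 by apply: punctE => //; clear; lia.
have b2 := good_diag g pb.
have a2 : (f r r.+1).2 = true.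
  by have := good_col g pa pb (ltnSn _); rewrite /collt eab; case: (f r r.+1).2; clear; lia.
rewrite {1}/diagfix eqxx eab.
have eb : f r.+1 r.+1 = ((f r.+1 r.+1).1, false) by rewrite -b2 -surjective_pairing.
rewrite -eb; set b := f r.+1 r.+1; set f' := upd _ _ _ _.
have f'b c' : (c' == r) || (c' == r.+1) -> f' r c' = b.
  by rewrite /f' /upd eqxx /=; case: ifP => //= _; rewrite orbF => ->.
have f'n r' c' : (r' != r) || (c' != r) && (c' != r.+1) -> f' r' c' = f r' c'.
  by move=> h; rewrite /f' !upd_neq //; qlia.
have above r1 c1 : S r1 c1 -> r1 < r -> c1 <= r.+1 -> collt (f r1 c1) b /\ 
    (c1 <= r -> (f r1 c1).1 < b.1).
  move=> s lt1 lt2; have s' : S r1 r.+1.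
    by have h := region_le regS s; apply: (region_convex regS s s1); qlia.
  have h : collt (f r1 r.+1) (f r r.+1).
    by apply: (good_col g) => //; try (apply: punctE => //); qlia.
  split; last first.
    move=> le; rewrite /b -eab; apply: (rowlt_collt _ h).
    by apply: (good_row g) => //; try (apply: punctE => //); qlia.
  case: (eqVneq c1 r.+1) => [->|ne]; first by move: h; rewrite /collt /b eab.
  apply: collt_lt; rewrite /b -eab; apply: (rowlt_collt _ h).
  by apply: (good_row g) => //; try (apply: punctE => //); qlia.
split.
- move=> r' c1 c2 /punctI[p1 n1] /punctI[p2 n2] lt.
  case: (eqVneq r' r) => [e|ne]; last first.
    by rewrite !f'n ?ne //; apply: (good_row g) => //; apply: punctE => //; qlia.
  subst r'; have le1 := region_le regS p1; have le2 := region_le regS p2.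
  have rb c' : c' > r.+1 -> S r c' -> rowlt b (f' r c').
    move=> lt' s; rewrite f'n; last by qlia.
    have : rowlt (f r r.+1) (f r c') by apply: (good_row g) => //; apply: punctE => //; qlia.
    by rewrite /rowlt -eab.
  case: (leqP c1 r.+1) => h1; last first.
    by rewrite !f'n; [apply: (good_row g) => //; apply: punctE => //; qlia|qlia..].
  rewrite (f'b c1); last by qlia.
  case: (leqP c2 r.+1) => h2; last exact: rb.
  by rewrite f'b; [rewrite /rowlt b2; clear; lia|qlia].
- move=> c' r1 r2 /punctI[p1 n1] /punctI[p2 n2] lt.
  have le1 := region_le regS p1; have le2 := region_le regS p2.
  case: (boolP ((c' == r) || (c' == r.+1))) => hc; last first.
    by rewrite !f'n; [apply: (good_col g) => //; apply: punctE => //; qlia|qlia..].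
  have h2 : r2 <= r by qlia.
  rewrite (f'n r1); last by qlia.
  case: (eqVneq r2 r) => [e|ne]; last first.
    by rewrite f'n; [apply: (good_col g) => //; apply: punctE => //; qlia|qlia].
  by subst r2; rewrite f'b //; apply: (proj1 (above _ _ p1 _ _)); qlia.
- move=> r' /punctI[p n]; case: (eqVneq r' r) => [->|ne]; first by rewrite f'b ?eqxx.
  by rewrite f'n ?ne //; apply: (good_diag g); apply: punctE => //; qlia.
- move=> r' s /punctI[p1 n1] /punctI[p2 n2] lt.
  case: (eqVneq r' r) => [e|ne1].
    subst r'; rewrite f'b ?eqxx // f'n; last by qlia.
    by apply: (good_diag_lt g) => //; try (apply: punctE => //); qlia.
  rewrite (f'n r') ?ne1 //; case: (eqVneq s r) => [e|ne2].
    by subst s; rewrite f'b ?eqxx //; apply: (proj2 (above _ _ p1 _ _)); qlia.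
  rewrite f'n ?ne2 //; apply: (good_diag_lt g) => //; apply: punctE => //; qlia.
- move=> r' c' /punctI[p n]; case: (boolP ((r' == r) && ((c' == r) || (c' == r.+1)))) => h.
    have -> : r' = r by qlia.
    by rewrite f'b; [apply: (good_valid g)|qlia].
  by rewrite f'n; [apply: (good_valid g); apply: punctE => //; qlia|qlia].
Qed.

End Moves.

(** * Slides preserve the endpoints of the walks *)

Lemma rowseg_cat P f s t r : rowseg P f (s ++ t) r = rowseg P f s r ++ rowseg P f t r.
Proof. by rewrite /rowseg filter_cat map_cat. Qed.

Lemma rowseg_cons (P : nat -> nat -> bool) f c s r : rowseg P f (c :: s) r =
  if P r c then f r c :: rowseg P f s r else rowseg P f s r.
Proof. by rewrite /rowseg /=; case: ifP. Qed.

Lemma eq_rowseg (P P' : nat -> nat -> bool) (f f' : nat -> nat -> letter) s r :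
  (forall c, c \in s -> P r c = P' r c) ->
  (forall c, c \in s -> P r c -> f r c = f' r c) ->
  rowseg P f s r = rowseg P' f' s r.
Proof.
move=> hP hf; rewrite /rowseg (eq_in_filter (hP)); apply/eq_in_map => c.
by rewrite mem_filter => /andP[p cs]; apply: hf => //; rewrite hP.
Qed.

Lemma rowseg0 (P : nat -> nat -> bool) f s r : (forall c, c \in s -> ~~ P r c) ->
  rowseg P f s r = [::].
Proof.
move=> h; rewrite /rowseg (@eq_in_filter _ _ pred0) ?filter_pred0 // => c cs.
exact: negbTE (h c cs).
Qed.

Lemma iota_split m n k : m <= k < m + n ->
  iota m n = iota m (k - m) ++ k :: iota k.+1 (m + n - k.+1).
Proof.
move=> h; have -> : n = (k - m) + (m + n - k.+1).+1 by lia.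
by rewrite iotaD /=; congr (_ ++ _ :: iota _ _); lia.
Qed.

(** Reading all cells of a fixed box that satisfy [P] lets the words before and after a move be cut
    at the same rows and columns, whatever their shapes. *)
Definition rows M P f s := flatten [seq rowseg P f (iota 0 M) r | r <- rev s].
Definition rd N M P f := rows M P f (iota 0 N).

Lemma rows_cat M P f s t : rows M P f (s ++ t) = rows M P f t ++ rows M P f s.
Proof. by rewrite /rows rev_cat map_cat flatten_cat. Qed.

Lemma rows1 M P f r : rows M P f [:: r] = rowseg P f (iota 0 M) r.
Proof. by rewrite /rows /= cats0. Qed.

Lemma rows_cons M P f r s : rows M P f (r :: s) = rows M P f s ++ rowseg P f (iota 0 M) r.
Proof. by rewrite -cat1s rows_cat rows1. Qed.

Lemma eq_rows M (P P' : nat -> nat -> bool) (f f' : nat -> nat -> letter) s :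
  (forall r c, r \in s -> P r c = P' r c) ->
  (forall r c, r \in s -> P r c -> f r c = f' r c) ->
  rows M P f s = rows M P' f' s.
Proof.
move=> hP hf; congr flatten; apply/eq_in_map => r; rewrite mem_rev => rs.
by apply: eq_rowseg => c _; [apply: hP|apply: hf].
Qed.

Lemma rd_split N M P f r : r < N -> rd N M P f =
  rows M P f (iota r.+1 (N - r.+1)) ++ rowseg P f (iota 0 M) r ++ rows M P f (iota 0 r).
Proof.
move=> h; rewrite /rd (@iota_split 0 N r) ?subn0 //.
by rewrite rows_cat rows_cons add0n catA.
Qed.

Lemma rd_split2 N M P f r : r.+1 < N -> rd N M P f =
  rows M P f (iota r.+2 (N - r.+2)) ++ rowseg P f (iota 0 M) r.+1 ++
  rowseg P f (iota 0 M) r ++ rows M P f (iota 0 r).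
Proof.
move=> h; rewrite (rd_split _ _ _ (ltnW h)).
rewrite (@iota_split r.+1 (N - r.+1) r.+1) ?subnn /=; last by lia.
rewrite rows_cons -catA; have -> : r.+1 + (N - r.+1) - r.+2 = N - r.+2 by lia.
by [].
Qed.

Lemma rowseg_split M (P : nat -> nat -> bool) f r c : c < M -> rowseg P f (iota 0 M) r =
  rowseg P f (iota 0 c) r ++
  (if P r c then f r c :: rowseg P f (iota c.+1 (M - c.+1)) r
   else rowseg P f (iota c.+1 (M - c.+1)) r).
Proof.
move=> h; rewrite {1}(@iota_split 0 M c) ?subn0 //.
by rewrite rowseg_cat rowseg_cons add0n.
Qed.

Lemma mem_rows M (P : nat -> nat -> bool) f s (x : letter) : x \in rows M P f s ->
  exists (r c : nat), [/\ r \in s, P r c & x = f r c].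
Proof.
case/flattenP => w /mapP[r rs ->] /mapP[c]; rewrite mem_filter => /andP[p _] ->.
by exists r, c; rewrite mem_rev in rs.
Qed.

Lemma act_fst0 i u pt : (forall x : letter, x \in u -> x.1 != i) -> pt.1 = 0 ->
  (act i u pt).1 = 0.
Proof.
elim: u pt => // x u IH pt h p0; rewrite act_cons; apply: IH => [y yu|].
  by apply: h; rewrite inE yu orbT.
rewrite act1 (negPf (h x _)) ?inE ?eqxx //; case: ifP => // _.
by case: pt p0 => [a b] /= ->; case: (x.2).
Qed.

Lemma act_snd0 i u pt : (forall x : letter, x \in u -> x.1 != i.+1) -> pt.2 = 0 ->
  (act i u pt).2 = 0.
Proof.
elim: u pt => // x u IH pt h p0; rewrite act_cons; apply: IH => [y yu|].
  by apply: h; rewrite inE yu orbT.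
rewrite act1 (negPf (h x _)) ?inE ?eqxx //; case: ifP => // _.
by case: pt p0 => [a b] /= ->; case: (x.2); rewrite andbF.
Qed.

(** Before the first letter of value i the walk has x = 0, before the first of value i+1 it has y =
    0; on an axis the prime is ignored. *)
Lemma act_unprime i u x v : (forall y : letter, y \in u -> y.1 != x.1) ->
  act i (u ++ x :: v) (0, 0) = act i (u ++ (x.1, false) :: v) (0, 0).
Proof.
move=> h; rewrite !act_cat act_cons [RHS]act_cons; congr act; rewrite !act1 /=.
case: eqP => [e|_].
  have := @act_fst0 i u (0, 0) _ erefl; rewrite -e => /(_ h).
  by case: (act _ _ _) => [a b] /= ->; case: (x.2).
case: eqP => [e|//]; have := @act_snd0 i u (0, 0) _ erefl; rewrite -e => /(_ h).
by case: (act _ _ _) => [a b] /= ->; rewrite andbF; case: (x.2).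
Qed.

Lemma good_below P f r c r' c' : good P f -> P r c -> P r c' -> P r' c' ->
  c < c' -> r < r' -> (f r c).1 < (f r' c').1.
Proof.
move=> g p1 p2 p3 l1 l2.
by apply: rowlt_collt (good_row g p1 p2 l1) (good_col g p2 p3 l2).
Qed.

(** The letter at (r,r) is the first of its value in the word, so its prime may be changed. *)
Lemma act_diag i N M (P : nat -> nat -> bool) f r a :
    r < N -> r < M -> P r r -> (forall r' c', P r' c' -> r' <= c') ->
    (forall r' c', P r' c' -> r < r' -> (f r r).1 < (f r' c').1) -> a.1 = (f r r).1 ->
  act i (rd N M P (upd f r r a)) (0, 0) = act i (rd N M P f) (0, 0).
Proof.
move=> rN rM prr tri below ea.
have E f' : (forall r' c', (r' != r) || (c' != r) -> f' r' c' = f r' c') ->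
    rd N M P f' = rows M P f (iota r.+1 (N - r.+1)) ++ f' r r ::
     (rowseg P f (iota r.+1 (M - r.+1)) r ++ rows M P f (iota 0 r)).
  move=> h; rewrite (rd_split _ _ _ rN); congr (_ ++ _).
    by apply: eq_rows => // r' c'; rewrite mem_iota => lt _; apply: h; lia.
  rewrite (rowseg_split _ _ _ rM) prr rowseg0; last first.
    by move=> c'; rewrite mem_iota => lt; apply/negP => /tri; lia.
  rewrite cat0s cat_cons; congr (_ :: _ ++ _).
    by apply: eq_rowseg => // c'; rewrite mem_iota => lt _; apply: h; lia.
  by apply: eq_rows => // r' c'; rewrite mem_iota => lt _; apply: h; lia.
have hu y : y \in rows M P f (iota r.+1 (N - r.+1)) -> y.1 != (f r r).1.
  case/mem_rows => r' [c' [r's p ->]]; rewrite mem_iota in r's.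
  have lt : r < r' by lia.
  by have := below _ _ p lt; case: ltngtP.
rewrite [rd N M P (upd _ _ _ _)]E; last by move=> *; rewrite upd_neq.
rewrite [rd N M P f]E // upd_eq act_unprime; last by move=> y /hu; rewrite ea.
by rewrite [RHS]act_unprime // ea.
Qed.

Lemma puncture_hole S r c : puncture S r c r c = false.
Proof. by rewrite /puncture !eqxx andbF. Qed.
Lemma puncture_other S r c r' c' : (r' != r) || (c' != c) -> puncture S r c r' c' = S r' c'.
Proof. by rewrite /puncture; case: (S r' c') => //=; lia. Qed.

Section MovesAct.
Variables (S : nat -> nat -> bool) (N M : nat).
Hypothesis regS : region S.
Hypothesis bndS : forall r c, S r c -> r < N /\ c < M.

Lemma rd_right_move r c f : S r c -> S r c.+1 ->
  rd N M (puncture S r c.+1) (upd f r c (f r c.+1)) = rd N M (puncture S r c) f.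
Proof.
move=> s0 s1; have [rN cM] := bndS s0; have [_ cM'] := bndS s1.
rewrite !(rd_split _ _ _ rN); congr (_ ++ _ ++ _).
- apply: eq_rows => r' c'; rewrite mem_iota /puncture => h; last by rewrite upd_neq //; qlia.
  by case: (S r' c') => //=; qlia.
- rewrite !(rowseg_split _ _ _ cM) puncture_hole.
  rewrite (@puncture_other _ r c.+1 r c) ?s0 ?upd_eq; last by qlia.
  congr (_ ++ _).
    apply: eq_rowseg => c'; rewrite mem_iota /puncture => h; last by rewrite upd_neq //; qlia.
    by case: (S r c') => //=; qlia.
  have eqi : iota c.+1 (M - c.+1) = c.+1 :: iota c.+2 (M - c.+2).
    by rewrite -(subnSK cM').
  rewrite eqi !rowseg_cons puncture_hole puncture_other ?s1; last by qlia.
  congr (_ :: _).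
  apply: eq_rowseg => c'; rewrite mem_iota /puncture => h; last by rewrite upd_neq //; qlia.
  by case: (S r c') => //=; qlia.
- apply: eq_rows => r' c'; rewrite mem_iota /puncture => h; last by rewrite upd_neq //; qlia.
  by case: (S r' c') => //=; qlia.
Qed.

(** The word itself is unchanged except for a prime lost on the diagonal, which [act_diag]
    allows. *)
Lemma act_right_move i r c f : S r c -> S r c.+1 -> good (puncture S r c) f ->
    (S r.+1 c -> collt (f r c.+1) (f r.+1 c)) ->
    (r = c -> S r.+1 r.+1 -> (f r r.+1).1 < (f r.+1 r.+1).1) ->
  act i (rd N M (puncture S r c.+1) (upd f r c (diagfix r c (f r c.+1)))) (0, 0) =
  act i (rd N M (puncture S r c) f) (0, 0).
Proof.
move=> s0 s1 g hb hd; have [rN cM] := bndS s0.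
rewrite -(rd_right_move f s0 s1).
case: (eqVneq r c) => [e|ne]; last by rewrite diagfix_id.
have g' := good_right_move regS s0 s1 g hb hd.
subst c; set a := diagfix _ _ _ in g' *.
have ea : a.1 = (f r r.+1).1 by rewrite /a diagfix1.
have -> : rd N M (puncture S r r.+1) (upd f r r (f r r.+1)) =
          rd N M (puncture S r r.+1) (upd (upd f r r a) r r (f r r.+1)).
  by apply: eq_rows => // r' c' _ _; rewrite /upd; case: ifP.
symmetry; apply: act_diag => //; last by rewrite upd_eq ea.
- by apply: punctE => //; qlia.
- by move=> r' c' /andP[/(region_le regS)].
- move=> r' c' p lt; have [s n] := punctI p; have le := region_le regS s.
  have p0 : puncture S r r.+1 r r by apply: punctE => //; qlia.
  case: (eqVneq c' r.+1) => [e|ne].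
    have er : r' = c' by qlia.
    by subst r'; apply: (good_diag_lt g').
  apply: (good_below g') => //; last by qlia.
  by apply: punctE; [apply: (region_convex regS s0 s); qlia|qlia].
Qed.

Lemma act_up_move i r c f : S r c -> S r.+1 c -> good (puncture S r c) f ->
    (forall c', c < c' -> S r c' -> rowlt (f r.+1 c) (f r c')) ->
  act i (rd N M (puncture S r.+1 c) (upd f r c (f r.+1 c))) (0, 0) =
  act i (rd N M (puncture S r c) f) (0, 0).
Proof.
move=> s0 s1 g bD; have [_ cM] := bndS s0; have [rN _] := bndS s1.
have lt_rc := region_le regS s1.
rewrite !(rd_split2 _ _ _ rN) !(rowseg_split _ _ _ cM).
rewrite !puncture_hole (@puncture_other _ r.+1 c r c) ?(@puncture_other _ r c r.+1 c) ?s0 ?s1;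
  [|qlia..].
rewrite upd_eq.
have low P' f' : (forall r' c', r.+1 < r' -> P' r' c' = S r' c') ->
    (forall r' c', r.+1 < r' -> f' r' c' = f r' c') ->
    rows M P' f' (iota r.+2 (N - r.+2)) = rows M S f (iota r.+2 (N - r.+2)).
  by move=> hP hf; apply: eq_rows => r' c'; rewrite mem_iota => h;
    [rewrite hP //|move=> _; rewrite hf //]; qlia.
rewrite (low (puncture S r.+1 c)); last 2 first.
- by move=> r' c' h; rewrite /puncture; case: (S r' c') => //=; qlia.
- by move=> r' c' h; rewrite upd_neq //; qlia.
rewrite (low (puncture S r c)); last 2 first.
- by move=> r' c' h; rewrite /puncture; case: (S r' c') => //=; qlia.
- by [].
have up : rows M (puncture S r.+1 c) (upd f r c (f r.+1 c)) (iota 0 r) =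
          rows M (puncture S r c) f (iota 0 r).
  apply: eq_rows => r' c'; rewrite mem_iota /puncture => h; last by rewrite upd_neq //; qlia.
  by case: (S r' c') => //=; qlia.
have seg P' f' r' c0 m : (r' == r) || (r' == r.+1) ->
    (forall c', c0 <= c' < c0 + m -> P' r' c' = S r' c') ->
    (forall c', c0 <= c' < c0 + m -> f' r' c' = f r' c') ->
    rowseg P' f' (iota c0 m) r' = rowseg S f (iota c0 m) r'.
  by move=> _ hP hf; apply: eq_rowseg => c'; rewrite mem_iota => h;
    [rewrite hP|move=> _; rewrite hf].
rewrite up !act_cat; congr act; rewrite -!act_cat.
rewrite !(seg (puncture S r.+1 c)) ?eqxx ?orbT //; last first;
  try (move=> c' h; rewrite /puncture; case: (S _ c') => //=; qlia);
  try (by move=> c' h; rewrite upd_neq //; qlia).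
rewrite !(seg (puncture S r c)) ?eqxx ?orbT //; last first;
  try (move=> c' h; rewrite /puncture; case: (S _ c') => //=; qlia).
rewrite [LHS]act_cat [RHS]act_cat cat_cons.
symmetry; apply: (@up_move_act S f r c _ i) => // srr e.
(* In the critical diagonal case the rows already read hold only values above i+1, so the walk is
   still at the origin. *)
have gt (x : letter) : x \in rows M S f (iota r.+2 (N - r.+2)) -> i.+1 < x.1.
  case/mem_rows => r' [c' [r's s ->]]; rewrite mem_iota in r's.
  have le := region_le regS s.
  have s' : S r.+1 r.+1 by apply: (region_convex regS srr s1); qlia.
  have s'' : S r.+1 c' by apply: (region_convex regS s' s); qlia.
  by rewrite -e; apply: (good_below g (punctE s' _) (punctE s'' _) (punctE s _)); qlia.
by apply: act_skip => x /gt; qlia.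
Qed.

(** With b = j and a = j', the word low b B a D top becomes low B b b D top, where low holds only
    values above j. *)
Lemma act_diag_move i r f : S r r -> S r.+1 r.+1 -> good (puncture S r r) f ->
    (f r r.+1).1 = (f r.+1 r.+1).1 ->
  act i (rd N M (puncture S r.+1 r.+1)
    (upd (upd f r r (diagfix r r (f r r.+1))) r r.+1 (f r.+1 r.+1))) (0, 0) =
  act i (rd N M (puncture S r r) f) (0, 0).
Proof.
move=> s0 s2 g eab; have [_ rM0] := bndS s0; have [rN rM] := bndS s2.
have s1 : S r r.+1 by apply: (region_convex regS s0 s2); qlia.
have pb : puncture S r r r.+1 r.+1 by apply: punctE => //; qlia.
have pa : puncture S r r r r.+1 by apply: punctE => //; qlia.
have b2 := good_diag g pb.
have a2 : (f r r.+1).2 = true.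
  by have := good_col g pa pb (ltnSn _); rewrite /collt eab; case: (f r r.+1).2; clear; lia.
rewrite {1}/diagfix eqxx eab.
have eb : f r.+1 r.+1 = ((f r.+1 r.+1).1, false) by rewrite -b2 -surjective_pairing.
have ea : f r r.+1 = ((f r.+1 r.+1).1, true) by rewrite -a2 -eab -surjective_pairing.
rewrite -eb; set f' := upd _ _ _ _.
pose low := rows M S f (iota r.+2 (N - r.+2)).
pose B := rowseg S f (iota r.+2 (M - r.+2)) r.+1.
pose D := rowseg S f (iota r.+2 (M - r.+2)) r.
pose top := rows M S f (iota 0 r).
have tri r' k : k <= r' -> forall P' : nat -> nat -> bool, (forall c, P' r' c -> S r' c) ->
    forall h, rowseg P' h (iota 0 k) r' = [::].
  move=> le P' sub h; apply: rowseg0 => c; rewrite mem_iota => lt.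
  by apply/negP => /sub /(region_le regS); qlia.
have eqi : iota r.+1 (M - r.+1) = r.+1 :: iota r.+2 (M - r.+2) by rewrite -(subnSK rM).
have -> : rd N M (puncture S r r) f =
    low ++ (f r.+1 r.+1 :: B) ++ (f r r.+1 :: D) ++ top.
  rewrite (rd_split2 _ _ _ rN); congr (_ ++ _ ++ _ ++ _).
  - apply: eq_rows => // r' c'; rewrite mem_iota /puncture => h.
    by case: (S r' c') => //=; qlia.
  - rewrite (rowseg_split _ _ _ rM) pb tri //; last by move=> c /andP[].
    congr (_ :: _); apply: eq_rowseg => // c'; rewrite mem_iota /puncture => h.
    by case: (S _ c') => //=; qlia.
  - rewrite (rowseg_split _ _ _ rM0) tri //; last by move=> c /andP[].
    rewrite puncture_hole eqi rowseg_cons pa cat0s.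
    congr (_ :: _); apply: eq_rowseg => // c'; rewrite mem_iota /puncture => h.
    by case: (S _ c') => //=; qlia.
  - apply: eq_rows => // r' c'; rewrite mem_iota /puncture => h.
    by case: (S r' c') => //=; qlia.
have f'n r' c' : (r' != r) || (c' != r) && (c' != r.+1) -> f' r' c' = f r' c'.
  by move=> h; rewrite /f' !upd_neq //; qlia.
have f'b c' : (c' == r) || (c' == r.+1) -> f' r c' = f r.+1 r.+1.
  by rewrite /f' /upd eqxx /=; case: ifP => //= _; rewrite orbF => ->.
have -> : rd N M (puncture S r.+1 r.+1) f' =
    low ++ B ++ (f r.+1 r.+1 :: f r.+1 r.+1 :: D) ++ top.
  rewrite (rd_split2 _ _ _ rN); congr (_ ++ _ ++ _ ++ _).
  - apply: eq_rows => r' c'; rewrite mem_iota /puncture => h; last by rewrite f'n //; qlia.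
    by case: (S r' c') => //=; qlia.
  - rewrite (rowseg_split _ _ _ rM) tri //; last by move=> c /andP[].
    rewrite puncture_hole cat0s.
    apply: eq_rowseg => c'; rewrite mem_iota /puncture => h; last by rewrite f'n //; qlia.
    by case: (S _ c') => //=; qlia.
  - rewrite (rowseg_split _ _ _ rM0) tri //; last by move=> c /andP[].
    rewrite puncture_other ?s0; last by qlia.
    rewrite eqi rowseg_cons puncture_other ?s1; last by qlia.
    rewrite !f'b ?eqxx ?orbT // cat0s.
    congr [:: _, _ & _]; apply: eq_rowseg => c'; rewrite mem_iota /puncture => h;
      last by rewrite f'n //; qlia.
    by case: (S _ c') => //=; qlia.
  - apply: eq_rows => r' c'; rewrite mem_iota /puncture => h; last by rewrite f'n //; qlia.
    by case: (S r' c') => //=; qlia.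
have inS r' c' : S r' c' -> (r' != r) || (c' != r) -> puncture S r r r' c' by exact: punctE.
have lowgt (x : letter) : x \in low -> (f r.+1 r.+1).1 < x.1.
  case/mem_rows => r' [c' [r's s ->]]; rewrite mem_iota in r's.
  have le := region_le regS s.
  have s'' : S r.+1 c' by apply: (region_convex regS s2 s); qlia.
  by apply: (good_below g (inS _ _ s2 _) (inS _ _ s'' _) (inS _ _ s _)); qlia.
set b := f r.+1 r.+1 in eb ea lowgt *.
have rowB c' : r.+1 < c' -> S r.+1 c' ->
    [/\ S r c', rowlt (f r r.+1) (f r c'), collt (f r c') (f r.+1 c') & b.1 < (f r.+1 c').1].
  move=> lt s; have s' : S r c' by apply: (region_convex regS s1 s); qlia.
  have h1 : rowlt (f r r.+1) (f r c') by apply: (good_row g); [| apply: inS => //; qlia|].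
  have h2 : collt (f r c') (f r.+1 c') by apply: (good_col g); try (apply: inS => //; qlia).
  by split=> //; rewrite /b -eab; apply: rowlt_collt h1 h2.
have rowD c' : r.+1 < c' -> S r c' -> rowlt (f r r.+1) (f r c').
  by move=> lt s; apply: (good_row g); [| apply: inS => //; qlia|].
have pB : pairwise rowlt B.
  by apply: pairwise_rowseg => c1 c2 h1 h2 lt; apply: (good_row g) => //; apply: inS => //;
    qlia.
have pD : pairwise rowlt D.
  rewrite /D (@eq_rowseg S (puncture S r r) f f) //; last first.
    by move=> c'; rewrite mem_iota /puncture; case: (S r c') => //=; qlia.
  by apply: pairwise_rowseg => c1 c2 h1 h2 lt; apply: (good_row g).
have zB (x : letter) : x.1 <= b.1 -> count_mem x B = 0.
  move=> le; apply: count_rowseg0 => c'; rewrite mem_iota => h s E.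
  by have [|_ _ _] := rowB c' _ s; [qlia|rewrite E; qlia].
have zD (x : letter) : ~~ rowlt (f r r.+1) x -> count_mem x D = 0.
  move=> /negP le; apply: count_rowseg0 => c'; rewrite mem_iota => h s E; apply: le.
  by rewrite -E; apply: rowD => //; qlia.
have -> : low ++ (b :: B) ++ (f r r.+1 :: D) ++ top =
    low ++ ([:: b] ++ B ++ [:: f r r.+1] ++ D) ++ top by rewrite /= -!catA.
have -> : low ++ B ++ [:: b, b & D] ++ top = low ++ (B ++ [:: b; b] ++ D) ++ top.
  by rewrite -!catA.
rewrite !act_cat; congr act.
have le1 x (w : seq letter) : pairwise rowlt w -> count_mem (x, true) w <= 1.
  exact: count_primed_le1.
case: (eqVneq b.1 i) => [e|ne].
  have p0 : (act i low (0, 0)).1 = 0.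
    by apply: act_fst0 => // x /lowgt; rewrite e; qlia.
  (* A positive height means that i+1 occurs in low. Then the diagonal letter of row r+2 is i+1,
     unprimed, and the letter of B above it exceeds i in value, so it is (i+1)'. *)
  have py : 0 < (act i low (0, 0)).2 -> 0 < count_mem (i.+1, true) B.
    move=> y0.
    case: (boolP (has (fun x => x.1 == i.+1) low)) => [/hasP[x]|/hasPn none]; last first.
      by move: y0; rewrite act_snd0.
    case/mem_rows => r' [c' [r's s ->]] /= /eqP ex; rewrite mem_iota in r's.
    have le := region_le regS s.
    have s3 : S r.+2 r.+2 by apply: (region_convex regS s2 s); qlia.
    have s4 : S r.+1 r.+2 by apply: (region_convex regS s2 s3); qlia.
    have [|_ _ _ lt1] := rowB r.+2 _ s4; first by [].
    have h3 : collt (f r.+1 r.+2) (f r.+2 r.+2).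
      by apply: (good_col g) => //; apply: inS => //; qlia.
    have d3 : (f r.+2 r.+2).2 = false by apply: (good_diag g); apply: inS => //; qlia.
    have l3 : (f r.+2 r.+2).1 <= i.+1.
      case: (eqVneq c' r.+2) => [ec|nc].
        by have er : r' = r.+2 by [qlia]; subst c' r'; rewrite ex.
      have s5 : S r.+2 c' by apply: (region_convex regS s3 s); qlia.
      have p3 : puncture S r r r.+2 r.+2 by apply: inS => //; qlia.
      have p5 : puncture S r r r.+2 c' by apply: inS => //; qlia.
      have p6 : puncture S r r r' c' by apply: inS => //; qlia.
      have l5 : r.+2 < c' by qlia.
      case: (eqVneq r' r.+2) => [er|nr].
        by have := good_row g p3 p5 l5; subst r'; rewrite /rowlt ex; clear; lia.
      have l6 : r.+2 < r' by qlia.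
      by have := good_below g p3 p5 p6 l5 l6; rewrite ex; clear; lia.
    have ex' : f r.+1 r.+2 = (i.+1, true).
      move: h3 lt1 l3 d3; rewrite /collt e [f r.+1 r.+2]surjective_pairing /=.
      by case: (f r.+1 r.+2) => u [|] /= h3 lt1 l3 d3; [congr pair|]; qlia.
    rewrite -has_count; apply/hasP; exists (f r.+1 r.+2); last by rewrite /= ex'.
    by apply: map_f; rewrite mem_filter s4 mem_iota; have [_] := bndS s4; qlia.
  have bstep pt : act i [:: b] pt = walk1 1 pt by rewrite eb e (proj1 (act1_step _ _ _)).
  have astep pt : act i [:: f r r.+1] pt = east 1 pt by rewrite ea e (proj1 (act1_step _ _ _)).
  have bb pt : act i [:: b; b] pt = walk1 2 pt.
    by rewrite -(foldl_walk1 2) /act /sub_walk_word /= eb e /= eqxx /= subnn.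
  rewrite bstep astep bb.
  rewrite !(act_sorted _ _ pB) !(act_sorted _ _ pD).
  rewrite !(zB (i, _)) ?e // !(zD (i, true)) ?walk0; last by rewrite ea /rowlt e /=; qlia.
  case: (act i low (0, 0)) p0 py => x y /= -> py.
  symmetry; apply: walk_diag1; [exact: le1|exact: le1| |exact: py].
  rewrite !count_rowseg2; [|by rewrite -pair_eqE /pair_eq /=; qlia..].
  apply: leq_count_in => c'; rewrite mem_iota => cc' /andP[fx Sx].
  have [|S' h1 h2 _] := rowB c' _ Sx; first by qlia.
  rewrite S' andbT; move: h1 h2 fx; rewrite ea e /rowlt /collt -!pair_eqE /pair_eq /=.
  by case: (f r c') => u [|]; case: (f r.+1 c') => u' [|] /=; qlia.
case: (eqVneq b.1 i.+1) => [e|ne'].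
  (* From the origin b steps north; at x = 0 the letter a also steps north, exactly like a second
     b. *)
  have p0 : act i low (0, 0) = (0, 0).
    by apply: act_skip => x /lowgt; rewrite e; qlia.
  have bstep pt : act i [:: b] pt = north 1 pt by rewrite eb e (proj2 (act1_step _ _ _)).
  have astep pt : act i [:: f r r.+1] pt = walk2p 1 pt.
    by rewrite ea e (proj2 (act1_step _ _ _)).
  have bb pt : act i [:: b; b] pt = north 2 pt.
    by rewrite -[[:: b; b]]/([:: b] ++ [:: b]) act_cat !bstep /north /= -addnA.
  rewrite p0 bstep astep bb.
  have z p : (count_mem (i, p) B = 0) * (count_mem (i.+1, p) B = 0).
    by split; apply: zB; rewrite e.
  by rewrite !(act_sorted _ _ pB) !z !walk0.
have bstep pt : act i [:: b] pt = pt by rewrite act1 (negPf ne) (negPf ne').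
have astep pt : act i [:: f r r.+1] pt = pt by rewrite act1 eab (negPf ne) (negPf ne').
by rewrite (act_cons i b [:: b]) !bstep astep.
Qed.

End MovesAct.

(** * Shifted shapes and complete slides *)

Lemma inshapeE l r c : inshape l r c = (r <= c) && (c < r + nth 0 l r).
Proof.
rewrite /inshape; case: (ltnP r (size l)) => //= h.
by rewrite nth_default // addn0; lia.
Qed.

Lemma strict_nth l r : strict_part l -> r < size l ->
  0 < nth 0 l r /\ nth 0 l r.+1 < nth 0 l r.
Proof.
case/andP => st /allP pos h; have p : 0 < nth 0 l r by apply: pos; exact: mem_nth.
split=> //; case: (ltnP r.+1 (size l)) => h'; last by rewrite nth_default.
by move/sortedP: st => /(_ 0 _ h').
Qed.

Lemma strict_of_nth l :
  (forall r, r < size l -> 0 < nth 0 l r /\ nth 0 l r.+1 < nth 0 l r) -> strict_part l.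
Proof.
move=> h; apply/andP; split.
  by apply/(sortedP 0) => r hr; case: (h r) => //; exact: ltnW.
by apply/(all_nthP 0) => r /h[].
Qed.

Lemma strict_nth_add l r r' : strict_part l -> r <= r' -> 0 < nth 0 l r' ->
  r' + nth 0 l r' <= r + nth 0 l r.
Proof.
move=> st; elim: r' => [|r' IH]; first by rewrite leqn0 => /eqP->.
rewrite leq_eqVlt => /predU1P[->//|lt] p.
have hr : r' < size l.
  by rewrite ltnNge; apply: contraL p => h; rewrite nth_default // ltnW.
by have [p1 p2] := strict_nth st hr; have := IH lt p1; lia.
Qed.

Lemma inshape_ideal l r c r' c' : strict_part l -> inshape l r' c' ->
  r <= r' -> c <= c' -> r <= c -> inshape l r c.
Proof.
rewrite !inshapeE => st h le1 le2 le3.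
by have := @strict_nth_add l r r' st le1; lia.
Qed.

Definition skew lam mu r c := inshape lam r c && ~~ inshape mu r c.

Lemma skew_region lam mu : strict_part lam -> strict_part mu -> region (skew lam mu).
Proof.
move=> sl sm; split=> [r c /andP[]|r c r' c' r'' c'' /andP[s1 n1] /andP[s2 n2] h1 h2 h3].
  by rewrite inshapeE => /andP[].
have le : r <= c by move: s1; rewrite inshapeE => /andP[].
apply/andP; split; first by apply: (inshape_ideal sl s2); lia.
by apply: contra n1 => s3; apply: (inshape_ideal sm s3); lia.
Qed.

Lemma skew_SE lam mu r c r' c' : strict_part mu -> skew lam mu r c ->
  inshape lam r' c' -> r <= r' -> c <= c' -> skew lam mu r' c'.
Proof.
move=> sm /andP[s1 n1] s2 l1 l2; rewrite /skew s2; apply: contra n1 => s3.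
by apply: (inshape_ideal sm s3) => //; move: s1; rewrite inshapeE => /andP[].
Qed.

Definition corner l r := r < size l /\
  (nth 0 l r.+1 < (nth 0 l r).-1 \/ r.+1 = size l).

(** The filter in [dec_row] could shift later rows, but a corner row of length 1 is the last row. *)
Lemma nth_dec_row l r r' : strict_part l -> corner l r ->
  nth 0 (dec_row l r) r' = if r' == r then (nth 0 l r).-1 else nth 0 l r'.
Proof.
move=> st [h hc]; have [p lt] := strict_nth st h; have /andP[_ /allP pos] := st.
rewrite /dec_row; case: (ltnP 1 (nth 0 l r)) => h1.
  rewrite (_ : [seq x <- _ | 0 < x] = set_nth 0 l r (nth 0 l r).-1).
    by rewrite nth_set_nth /=.
  apply/all_filterP/(all_nthP 0) => k; rewrite size_set_nth (maxn_idPr h) => hk.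
  rewrite nth_set_nth /=; case: eqP => _; first by lia.
  by apply: pos; exact: mem_nth.
have e1 : nth 0 l r = 1 by lia.
have er : r.+1 = size l by case: hc => //; lia.
have -> : set_nth 0 l r (nth 0 l r).-1 = rcons (take r l) 0.
  apply: (@eq_from_nth _ 0) => [|k].
    by rewrite size_set_nth size_rcons size_take h; lia.
  rewrite size_set_nth (maxn_idPr h) => hk.
  rewrite nth_set_nth nth_rcons size_take h /= e1.
  by case: (ltngtP k r) => hkr; [rewrite nth_take|lia|].
rewrite filter_rcons /= (_ : [seq x <- _ | 0 < x] = take r l); last first.
  by apply/all_filterP/allP => x /mem_take /pos.
case: (ltngtP r' r) => hr; rewrite ?e1.
- by rewrite nth_take.
- by rewrite !nth_default ?size_take ?h //; lia.
- by rewrite nth_default // size_take h hr.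
Qed.

Lemma dec_row_gt0 l r : all (leq 1) (dec_row l r).
Proof. exact: filter_all. Qed.

Lemma strict_dec_row l r : strict_part l -> corner l r -> strict_part (dec_row l r).
Proof.
move=> st cr; apply: strict_of_nth => k hk.
have p : 0 < nth 0 (dec_row l r) k.
  by have /allP := dec_row_gt0 l r; apply; exact: mem_nth.
split=> //; move: p; rewrite !(nth_dec_row _ st cr).
have lt j : 0 < nth 0 l j -> nth 0 l j.+1 < nth 0 l j.
  move=> p; apply: (strict_nth st _).2; rewrite ltnNge; apply: contraL p => h.
  by rewrite nth_default.
case: cr => h hc; have [p0 l0] := strict_nth st h.
case: (eqVneq k r) => [->|ne]; first rewrite gtn_eqF //.
  by case: hc => [//|e]; rewrite (nth_default _ (eq_leq (esym e))).
by case: (eqVneq k.+1 r) => [<-|_] p; have := lt k p; lia.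
Qed.

Lemma inshape_dec_row l r r' c' : strict_part l -> corner l r ->
  inshape (dec_row l r) r' c' =
  inshape l r' c' && ~~ ((r' == r) && (c' == r + (nth 0 l r).-1)).
Proof.
move=> st cr; rewrite !inshapeE nth_dec_row //.
have [p _] := strict_nth st cr.1.
by case: (eqVneq r' r) => [->|ne] /=; lia.
Qed.

Lemma corner_of_hole l r c : strict_part l -> inshape l r c -> ~~ inshape l r c.+1 ->
  ~~ inshape l r.+1 c -> corner l r /\ c = r + (nth 0 l r).-1.
Proof.
move=> st s; have hr : r < size l by move: s; rewrite /inshape; case: (r < size l).
have [p lt] := strict_nth st hr; rewrite !inshapeE in s * => n1 n2.
split; last by lia.
split=> //; case: (ltngtP r.+1 (size l)) => hs; [left|by lia|by right].
by have [p' _] := strict_nth st hs; lia.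
Qed.

Lemma good_ext P P' f : (forall r c, P r c = P' r c) -> good P f -> good P' f.
Proof.
move=> e [h1 h2 h3 h4 h5]; split.
- by move=> r c1 c2; rewrite -!e; exact: h1.
- by move=> c r1 r2; rewrite -!e; exact: h2.
- by move=> r; rewrite -!e; exact: h3.
- by move=> r s; rewrite -!e; exact: h4.
- by move=> r c; rewrite -!e; exact: h5.
Qed.

Lemma slide_holeS k lam f r c : slide_hole k.+1 lam f r c =
  if inshape lam r c.+1 || inshape lam r.+1 c then
    if (if inshape lam r c.+1 && inshape lam r.+1 c
        then (key (f r.+1 c) < key (f r c.+1)) ||
             ((key (f r c.+1) == key (f r.+1 c)) && ~~ (f r.+1 c).2)
        else inshape lam r.+1 c)
    then slide_hole k lam (upd f r c (diagfix r c (f r.+1 c))) r.+1 c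
    else slide_hole k lam (upd f r c (diagfix r c (f r c.+1))) r c.+1
  else (dec_row lam r, f).
Proof. by []. Qed.

Section SlideHole.
Variables (lam mu : seq nat) (N M : nat).
Hypotheses (sl : strict_part lam) (sm : strict_part mu).
Hypothesis bnd : forall r c, inshape lam r c -> r < N /\ c < M.
Let S := skew lam mu.
Let regS : region S := skew_region sl sm.

(** Each move lowers the fuel by one and raises r + c by one. The induction is strong because the
    exceptional slide spends two units at once. *)
Lemma slide_holeP k r c f : S r c -> good (puncture S r c) f -> N + M <= k + r + c ->
  exists r' c', [/\ S r' c', (slide_hole k lam f r c).1 = dec_row lam r',
    ~~ inshape lam r' c'.+1 /\ ~~ inshape lam r'.+1 c',
    good (puncture S r' c') (slide_hole k lam f r c).2 &
    forall i, act i (rd N M (puncture S r' c') (slide_hole k lam f r c).2) (0, 0) =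
              act i (rd N M (puncture S r c) f) (0, 0)].
Proof.
have bndS r' c' : S r' c' -> r' < N /\ c' < M by case/andP => /bnd.
elim/ltn_ind: k r c f => k IH r c f s g fuel.
have [rN cM] := bndS _ _ s.
set goal := fun res : seq nat * (nat -> nat -> letter) =>
  exists r' c', [/\ S r' c', res.1 = dec_row lam r',
    ~~ inshape lam r' c'.+1 /\ ~~ inshape lam r'.+1 c', good (puncture S r' c') res.2 &
    forall i, act i (rd N M (puncture S r' c') res.2) (0, 0) =
              act i (rd N M (puncture S r c) f) (0, 0)].
(* As r < N and c < M, at least two units of fuel remain. *)
rewrite -/(goal _); case: k IH fuel => [|[|k]] IH fuel; [qlia|qlia|].
have le_rc := region_le regS s.
have inR : inshape lam r c.+1 -> S r c.+1 by move=> h; apply: (skew_SE sm s h).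
have inB : inshape lam r.+1 c -> S r.+1 c by move=> h; apply: (skew_SE sm s h).
have toL r' c' : S r' c' -> inshape lam r' c' by case/andP.
have occ r' c' : S r' c' -> (r' != r) || (c' != c) -> valid_letter (f r' c').
  by move=> s' h; apply: (good_valid g); apply: punctE.
have up : S r.+1 c -> (forall c', c < c' -> S r c' -> rowlt (f r.+1 c) (f r c')) ->
    goal (slide_hole k.+1 lam (upd f r c (diagfix r c (f r.+1 c))) r.+1 c).
  move=> sB bD; have lt_rc := region_le regS sB.
  rewrite diagfix_id; last by qlia.
  have g' := good_up_move regS s sB g bD.
  have [||r' [c' [h1 h2 h3 h4 h5]]] := IH k.+1 _ r.+1 c _ sB g'; [qlia|qlia|].
  exists r', c'; split=> // i; rewrite h5.
  exact: (act_up_move regS bndS i s sB g bD).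
have right : S r c.+1 -> (S r.+1 c -> collt (f r c.+1) (f r.+1 c)) ->
    goal (slide_hole k.+1 lam (upd f r c (diagfix r c (f r c.+1))) r c.+1).
  move=> sR hb.
  case: (boolP [&& r == c, S r.+1 r.+1 & (f r r.+1).1 == (f r.+1 r.+1).1]) => hs; last first.
    have hd : r = c -> S r.+1 r.+1 -> (f r r.+1).1 < (f r.+1 r.+1).1.
      move=> e s2; subst c; move: hs; rewrite eqxx s2 /= => ne.
      have : collt (f r r.+1) (f r.+1 r.+1).
        by apply: (good_col g); try (apply: punctE => //); qlia.
      by move: ne; rewrite /collt; qlia.
    have g' := good_right_move regS s sR g hb hd.
    have [||r' [c' [h1 h2 h3 h4 h5]]] := IH k.+1 _ r c.+1 _ sR g'; [qlia|qlia|].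
    exists r', c'; split=> // i; rewrite h5.
    exact: (act_right_move regS bndS i s sR g hb hd).
  case/and3P: hs => /eqP e s2 /eqP eab; subst c.
  have g' := good_diag_move regS s s2 g eab.
  have va : valid_letter (f r r.+1) by apply: occ => //; qlia.
  have vb : valid_letter (f r.+1 r.+1) by apply: occ => //; qlia.
  have b2 : (f r.+1 r.+1).2 = false by apply: (good_diag g); apply: punctE => //; qlia.
  set a' := diagfix _ _ _ in g' *.
  (* The second move is upward: b has the value of the letter just moved, and [rowlt] ignores the
     prime of its left argument. *)
  have -> : slide_hole k.+1 lam (upd f r r a') r r.+1 =
      slide_hole k lam (upd (upd f r r a') r r.+1 (f r.+1 r.+1)) r.+1 r.+1.
    rewrite slide_holeS (toL _ _ s2) orbT andbT.
    rewrite (upd_neq f a' (r' := r.+1)); last by qlia.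
    rewrite diagfix_id ?(ltn_eqF (ltnSn r)) //.
    case hR2 : (inshape lam r r.+2) => //.
    rewrite upd_neq; last by qlia.
    have s3 : S r r.+2 by apply: (skew_SE sm s hR2); qlia.
    have v3 : valid_letter (f r r.+2) by apply: occ => //; qlia.
    rewrite -(rowltE vb v3) ifT //.
    have : rowlt (f r r.+1) (f r r.+2).
      by apply: (good_row g); try (apply: punctE => //); qlia.
    by rewrite /rowlt eab.
  have [||r' [c' [h1 h2 h3 h4 h5]]] := IH k _ r.+1 r.+1 _ s2 g'; [qlia|qlia|].
  exists r', c'; split=> // i; rewrite h5.
  exact: (act_diag_move regS bndS i s s2 g eab).
rewrite slide_holeS.
case hR: (inshape lam r c.+1); case hB: (inshape lam r.+1 c) => /=; last first.
- by exists r, c; rewrite hR hB.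
- apply: (up (inB hB)) => c' lt s'; have : S r c.+1 by apply: (region_convex regS s s'); qlia.
  by move/toL; rewrite hR.
- by apply: (right (inR hR)) => /toL; rewrite hB.
have sB := inB hB; have sR := inR hR.
have va : valid_letter (f r c.+1) by apply: occ => //; qlia.
have vb : valid_letter (f r.+1 c) by apply: occ => //; qlia.
rewrite -(rowltE vb va); case: ifP => [h|/negbT h].
  apply: up => // c' lt s'; case: (eqVneq c' c.+1) => [->//|ne].
  apply: (rowlt_trans h); apply: (good_row g); try (apply: punctE => //); qlia.
by apply: right => // _; rewrite colltE.
Qed.
End SlideHole.

(** * Rectification *)

Lemma rows0 M (P : nat -> nat -> bool) f s :
  (forall r c, r \in s -> ~~ P r c) -> rows M P f s = [::].
Proof.
elim: s => // r s IH h; rewrite rows_cons IH => [|r' c rs].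
  by apply: rowseg0 => c _; apply: h; rewrite inE eqxx.
by apply: h; rewrite inE rs orbT.
Qed.

Lemma reading_rd T N M : strict_part (outer T) ->
    (forall r c, inshape (outer T) r c -> r < N /\ c < M) ->
  reading T = rd N M (inskew T) (ent T).
Proof.
rewrite /inskew /reading; set lam := outer T; set mu := inner T => st bnd.
have szN : size lam <= N.
  case: (posnP (size lam)) => [->//|p].
  have [p1 _] := @strict_nth lam (size lam).-1 st (ltac:(lia)).
  have [] := bnd (size lam).-1 (size lam).-1; last by lia.
  by rewrite inshapeE; lia.
rewrite /rd -{1}(subnKC szN) iotaD rows_cat (@rows0 _ _ _ (iota (0 + size lam) _)); last first.
  move=> r c; rewrite mem_iota inshapeE => h.
  by rewrite nth_default ?addn0; lia.
rewrite cat0s; congr flatten; apply/eq_in_map => r _.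
rewrite /rowseg; congr map; apply: (irr_sorted_eq ltn_trans ltnn).
- exact: iota_ltn_sorted.
- by apply: sorted_filter; [exact: ltn_trans|exact: iota_ltn_sorted].
move=> c; rewrite mem_filter !mem_iota !inshapeE.
have : inshape lam r c -> c < M by move/bnd => [].
by rewrite inshapeE; lia.
Qed.

Definition ok T := [/\ strict_part (outer T), strict_part (inner T),
  (forall r, nth 0 (inner T) r <= nth 0 (outer T) r) & good (inskew T) (ent T)].

Lemma strict_bound l : strict_part l ->
  forall r c, inshape l r c -> r < size l /\ c < nth 0 l 0.
Proof.
move=> st r c h; have hr : r < size l by move: h; rewrite /inshape; case: (r < size l).
split=> //; move: h; rewrite inshapeE => h.
by have := @strict_nth_add l 0 r st; lia.
Qed.

(** This makes the fuel in [slide_at] sufficient for a hole to cross the bounding box. *)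
Lemma sumn_ge_size l : all (leq 1) l -> size l + nth 0 l 0 <= (sumn l).+1.
Proof.
case: l => //= x l /andP[x1 h].
have : size l <= sumn l by elim: l h => //= y l IH /andP[y1 /IH]; lia.
lia.
Qed.

(** Inside the region [skew lam (dec_row mu r)] the old tableau is the region punctured at the
    initial hole, the new one the region punctured at the final hole. *)
Lemma slide_at_ok T r : ok T -> inner_corner (inner T) r ->
  ok (slide_at T r) /\
  forall i, act i (reading (slide_at T r)) (0, 0) = act i (reading T) (0, 0).
Proof.
case: T => lam mu f [/= sl sm sub g] /andP[/andP[hr p] hc].
have cr : corner mu r by split=> //; case/orP: hc => [->|/eqP]; [left|right].
have sm' := strict_dec_row sm cr.
set N := size lam; set M := nth 0 lam 0.
have bnd := strict_bound sl; set c := r + (nth 0 mu r).-1.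
have sL : inshape lam r c by rewrite inshapeE /c; have := sub r; lia.
have s : skew lam (dec_row mu r) r c.
  by rewrite /skew sL inshape_dec_row // !eqxx andbF.
have eP r' c' : inskew (Tableau lam mu f) r' c' = puncture (skew lam (dec_row mu r)) r c r' c'.
  rewrite /inskew /puncture /skew /= inshape_dec_row // -/c.
  case: (boolP ((r' == r) && (c' == c))) => [/andP[/eqP-> /eqP->]|_]; last by rewrite !andbT.
  by rewrite andbF !inshapeE /c; lia.
have g0 := good_ext eP g.
have fuel : N + M <= (sumn lam).+1 + r + c.
  have := @sumn_ge_size lam; have /andP[_ h] := sl; rewrite h => /(_ isT).
  by rewrite -/N -/M; lia.
have [r' [c' [h1 h2 [n1 n2] h4 h5]]] := slide_holeP sl sm' bnd s g0 fuel.
have sL' : inshape lam r' c' by case/andP: h1.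
have [cr' ec'] := corner_of_hole sl sL' n1 n2.
rewrite /slide_at /= -/c; move: h2 h4 h5.
set res := slide_hole _ _ _ _ _ => h2 h4 h5; rewrite h2.
have eP' r1 c1 : puncture (skew lam (dec_row mu r)) r' c' r1 c1 =
    inskew (Tableau (dec_row lam r') (dec_row mu r) res.2) r1 c1.
  by rewrite /inskew /puncture /skew /= (inshape_dec_row _ _ sl cr') ec' andbAC.
have sl' := strict_dec_row sl cr'.
split=> [|i].
  split=> //=; last exact: good_ext h4.
  move=> k; rewrite (nth_dec_row _ sl cr') (nth_dec_row _ sm cr).
  have := sub k; case: (eqVneq k r') => [ek|_].
    2: by case: (eqVneq k r) => [->|_]; clear; lia.
  subst k; case/andP: h1 => _; rewrite !inshapeE (nth_dec_row _ sm cr) in sL' *.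
  by case: (eqVneq r' r) => [->|_]; lia.
rewrite (@reading_rd _ N M) //=; last first.
  by move=> r1 c1; rewrite inshape_dec_row // => /andP[/bnd].
rewrite (@reading_rd (Tableau lam mu f) N M) //.
rewrite [RHS](_ : _ = act i (rd N M (puncture (skew lam (dec_row mu r)) r c) f) (0, 0)).
  rewrite -h5; congr act; apply: eq_rows => // r1 c1 _; exact: esym (eP' _ _).
by congr act; apply: eq_rows => // r1 c1 _; exact: eP.
Qed.

Lemma rectifies_ok T R : rectifies T R -> ok T -> [/\ ok R, inner R = [::] &
  forall i, act i (reading R) (0, 0) = act i (reading T) (0, 0)].
Proof.
elim=> {T R} [T e okT|T r R hc _ IH okT]; first by split.
have [okS eS] := slide_at_ok okT hc; have [okR e eR] := IH okS.
by split=> // i; rewrite eR eS.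
Qed.

Lemma sumn_pos l : sumn [seq x <- l | 0 < x] = sumn l.
Proof. by elim: l => //= -[|x] l /= ->. Qed.

(** The last row of the inner shape is always a corner, and sliding there removes one inner cell. *)
Lemma rectifies_exists T : ok T -> exists R, rectifies T R.
Proof.
have [m] := ubnP (sumn (inner T)); elim: m T => // m IH T le okT.
case: (posnP (size (inner T))) => [/size0nil e|p].
  by exists T; apply: rect_done.
have [_ sm _ _] := okT; set mu := inner T in le sm p *.
have hr : (size mu).-1 < size mu by lia.
have [p1 l1] := strict_nth sm hr.
have hc : inner_corner mu (size mu).-1.
  by rewrite /inner_corner hr p1 /= prednK // eqxx orbT.
have [okS _] := slide_at_ok okT hc.
have [|R rR] := IH _ _ okS; last by exists R; apply: (rect_step hc).
rewrite ltnS in le; apply: leq_trans le; rewrite /= /dec_row sumn_pos.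
move: p1; rewrite -/mu; case/lastP: mu p {hr l1 sm hc okS} => // s x _.
rewrite size_rcons /= nth_rcons ltnn eqxx => p1.
have -> : set_nth 0 (rcons s x) (size s) x.-1 = rcons s x.-1.
  by elim: s => //= y s ->.
by rewrite -!cats1 !sumn_cat /=; lia.
Qed.

(** * Canonical words and their tableaux *)

Lemma canon_aux_first seen w u x v : canon_aux seen w = u ++ x :: v ->
  x.1 \notin seen -> (forall y : letter, y \in u -> y.1 != x.1) -> x.2 = false.
Proof.
elim: w seen u => [|a w IH] seen u /=; first by case: u.
case: ifP => ha; case: u => [|b u] /= [e1 e2] ns hu.
- by move: ns; rewrite -e1 ha.
- apply: (IH seen u) => // y yu; apply: hu; by rewrite inE yu orbT.
- by rewrite -e1.
- apply: (IH (a.1 :: seen) u) => // [|y yu]; last by apply: hu; rewrite inE yu orbT.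
  rewrite inE negb_or ns andbT eq_sym.
  by have := hu b; rewrite inE eqxx -e1 => /(_ isT).
Qed.

(** As long as one of the two values is unseen the walk is on an axis, where the prime that
    [canon_aux] removes has no effect. *)
Lemma act_canon_aux i seen w pt :
    (i \notin seen -> pt.1 = 0) -> (i.+1 \notin seen -> pt.2 = 0) ->
  act i (canon_aux seen w) pt = act i w pt.
Proof.
elim: w seen pt => // x w IH seen pt h1 h2 /=; rewrite [RHS]act_cons.
have keep s : (x.1 \in s) -> (forall j, j \notin s -> j \notin seen) -> 
  act i (canon_aux s w) (act i [:: x] pt) = act i w (act i [:: x] pt).
  move=> xs sub; apply: IH => hi.
    apply: act_fst0 => [y|]; last by apply: h1; apply: sub.
    by rewrite inE => /eqP->; apply: contraNneq hi => <-.
  apply: act_snd0 => [y|]; last by apply: h2; apply: sub.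
  by rewrite inE => /eqP->; apply: contraNneq hi => <-.
case: ifP => hx; first by rewrite act_cons keep.
rewrite [LHS]act_cons.
have -> : act i [:: (x.1, false)] pt = act i [:: x] pt.
  rewrite !act1 /=; case: eqP => [e|_].
    by case: pt h1 {h2 keep} => a b /=; rewrite -e hx => -> //; case: (x.2).
  case: eqP => [e|//]; case: pt h2 {h1 keep} => a b /=; rewrite -e hx => -> //.
  by rewrite andbF; case: (x.2).
by apply: keep => [|j]; rewrite inE ?eqxx // negb_or => /andP[].
Qed.

Lemma act_canon i w : act i (canon w) (0, 0) = act i w (0, 0).
Proof. exact: act_canon_aux. Qed.

Lemma canon_valid w : all (fun a => 0 < a.1) w -> all valid_letter (canon w).
Proof.
rewrite /canon; elim: w [::] => //= x w IH s /andP[h1 h2].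
by case: ifP => _ /=; rewrite /valid_letter /= h1 IH.
Qed.

(** A diagonal letter is the first of its value in the reading word, because all lower rows carry
    larger values; canonicity makes it unprimed. *)
Lemma semistandard_ok T w : semistandard T -> reading T = canon w -> ok T.
Proof.
case=> -[sl sm /andP[szc /allP con] val] [row col] rdT.
have sub r : nth 0 (inner T) r <= nth 0 (outer T) r.
  case: (ltnP r (size (inner T))) => h; last by rewrite nth_default.
  by apply: con; rewrite mem_iota.
have regS := skew_region sl sm; rewrite -/(inskew T) in regS.
have hrow r c1 c2 : inskew T r c1 -> inskew T r c2 -> c1 < c2 ->
    rowlt (ent T r c1) (ent T r c2).
  move=> p1; elim: c2 => // c2 IH p2; rewrite ltnS leq_eqVlt => lt.
  have le := region_le regS p1.
  have p3 : inskew T r c2 by apply: (region_convex regS p1 p2); case/orP: lt => [/eqP|]; lia.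
  have adj : rowlt (ent T r c2) (ent T r c2.+1).
    by apply/rowltP; [exact: val|exact: val|exact: row].
  by case/orP: lt => [/eqP->//|/(IH p3) h]; apply: rowlt_trans h adj.
have hcol c r1 r2 : inskew T r1 c -> inskew T r2 c -> r1 < r2 ->
    collt (ent T r1 c) (ent T r2 c).
  move=> p1; elim: r2 => // r2 IH p2; rewrite ltnS leq_eqVlt => lt.
  have le := region_le regS p2.
  have p3 : inskew T r2 c by apply: (region_convex regS p1 p2); case/orP: lt => [/eqP|]; lia.
  have adj : collt (ent T r2 c) (ent T r2.+1 c).
    by apply/collt_semistandard; [exact: val|exact: val|exact: col].
  by case/orP: lt => [/eqP->//|/(IH p3) h]; apply: collt_trans h adj.
have hlt r r' c' : inskew T r r -> inskew T r' c' -> r < r' ->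
    (ent T r r).1 < (ent T r' c').1.
  move=> p1 p2 lt; have le := region_le regS p2.
  have p3 : inskew T r c' by apply: (region_convex regS p1 p2); lia.
  by apply: rowlt_collt (hrow _ _ _ p1 p3 _) (hcol _ _ _ p3 p2 lt); lia.
split=> //; split=> // [r p|r s p1 p2 lt]; last exact: hlt.
have bnd := strict_bound sl.
have [rN rM] : r < size (outer T) /\ r < nth 0 (outer T) 0 by case/andP: p => /bnd.
rewrite (reading_rd sl bnd) (rd_split _ _ _ rN) (rowseg_split _ _ _ rM) p in rdT.
rewrite rowseg0 ?cat0s in rdT; last first.
  by move=> c; rewrite mem_iota => h; apply/negP => /(region_le regS); lia.
apply: (canon_aux_first (esym rdT)) => // y /mem_rows[r' [c' [r's p' ->]]].
rewrite mem_iota in r's.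
have lt : r < r' by lia.
by have := hlt _ _ _ p p' lt; case: ltngtP.
Qed.

Lemma antidiagonal_tableau w : all valid_letter w ->
  exists T, semistandard T /\ reading T = w.
Proof.
move=> /all_nthP val; pose m := size w.
have nth_lam (h : nat -> nat) r : (m <= r -> h r = 0) -> nth 0 (mkseq h m) r = h r.
  move=> hm; case: (ltnP r m) => lt; first by rewrite nth_mkseq.
  by rewrite nth_default ?size_mkseq // hm.
pose lam := mkseq (fun r => 2 * (m - r)) m.
(* Row lengths drop by 2 while rows shift right by 1, so the single cell of row r is in column 2m -
   r - 1 and no two cells are adjacent. Rows are read from the bottom, hence the index m - 1 - r. *)
pose mu := mkseq (fun r => 2 * (m - r) - 1) m.
have lamE r : nth 0 lam r = 2 * (m - r) by apply: nth_lam; lia.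
have muE r : nth 0 mu r = 2 * (m - r) - 1 by apply: nth_lam; lia.
pose T := Tableau lam mu (fun r c => nth (1, false) w (m.-1 - r)).
have sk r c : inskew T r c -> r < m /\ c = r + (2 * (m - r)).-1.
  by rewrite /inskew !inshapeE /= lamE muE; lia.
exists T; split.
  split; first split.
  - by apply: strict_of_nth => r; rewrite size_mkseq !lamE; lia.
  - by apply: strict_of_nth => r; rewrite size_mkseq !muE; lia.
  - apply/andP; split; first by rewrite /= !size_mkseq.
    by apply/allP => r _; rewrite /= lamE muE; lia.
  - by move=> r c /sk[h _]; apply: val; rewrite -/m; lia.
  by split=> r c /sk[h1 e1] /sk[h2 e2]; lia.
rewrite /reading /= size_mkseq.
rewrite (_ : map _ _ = [seq [:: nth (1, false) w (m.-1 - r)] | r <- rev (iota 0 m)]).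
2:{
  apply/eq_in_map => r; rewrite mem_rev mem_iota lamE muE => h.
  by have -> : 2 * (m - r) - (2 * (m - r) - 1) = 1 by lia. }
rewrite (_ : flatten _ = [seq nth (1, false) w (m.-1 - r) | r <- rev (iota 0 m)]); last first.
  by elim: (rev _) => //= r s ->.
rewrite map_rev; apply: (canLR revK); apply: (@eq_from_nth _ (1, false)).
  by rewrite size_map size_iota size_rev.
move=> k; rewrite size_map size_iota => hk.
rewrite (nth_map 0) ?size_iota // nth_iota // nth_rev // -/m.
by congr nth; lia.
Qed.

(** * Tableaux of straight shape *)

Section Straight.
Variable R : tableau.
Hypotheses (okR : ok R) (inR : inner R = [::]).

Let inskewE r c : inskew R r c = inshape (outer R) r c.
Proof. by rewrite /inskew inR {2}/inshape /= andbT. Qed.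

Let gR : good (inskew R) (ent R). Proof. by case: okR. Qed.
Let sR : strict_part (outer R). Proof. by case: okR. Qed.

(** The lower row lifts the walk to (0, y), with y its length. The row above is strictly longer: its
    first letter steps east and at least y letters follow to descend. *)
Lemma straight_ballot_walk i : 0 < i ->
  (forall r c, inshape (outer R) r c -> ent R r c = (r.+1, false)) ->
  (act i (reading R) (0, 0)).2 = 0.
Proof.
case: i => // i _ h; set lam := outer R.
(* The box is enlarged so that both rows lie in it even when they are empty. *)
have bnd r c : inshape lam r c -> r < size lam + i.+2 /\ c < nth 0 lam 0.
  by move/(strict_bound sR); rewrite -/lam => -[h1 h2]; split=> //; lia.
rewrite (reading_rd sR bnd) (@rd_split2 _ _ _ _ i); last by lia.
have val r c : inskew R r c -> (ent R r c).1 = r.+1 by rewrite inskewE => /h->.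
have skip s pt : (forall r, r \in s -> (r != i) && (r != i.+1)) ->
    act i.+1 (rows (nth 0 lam 0) (inskew R) (ent R) s) pt = pt.
  move=> hs; apply: act_skip => x /mem_rows[r [c [/hs rs p ->]]]; rewrite val //; lia.
have seg r : rowseg (inskew R) (ent R) (iota 0 (nth 0 lam 0)) r =
    nseq (nth 0 lam r) (r.+1, false).
  have e : [seq c <- iota 0 (nth 0 lam 0) | inskew R r c] = iota r (nth 0 lam r).
    apply: (irr_sorted_eq ltn_trans ltnn).
    - by apply: sorted_filter; [exact: ltn_trans|exact: iota_ltn_sorted].
    - exact: iota_ltn_sorted.
    move=> c; rewrite mem_filter !mem_iota inskewE inshapeE -/lam.
    by have := @strict_nth_add lam 0 r sR; lia.
  rewrite /rowseg e; apply: (@eq_from_nth _ (0, false)).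
    by rewrite size_map size_iota size_nseq.
  move=> k; rewrite size_map size_iota => hk.
  rewrite (nth_map 0) ?size_iota // nth_nseq hk nth_iota // h // inshapeE -/lam; lia.
rewrite !act_cat !skip; last 2 first.
- by move=> r; rewrite mem_iota; lia.
- by move=> r; rewrite mem_iota; lia.
have act2 k pt : act i.+1 (nseq k (i.+2, false)) pt = north k pt.
  rewrite -foldl_walk2 /act; congr foldl; elim: k => //= k IH.
  by rewrite sub_walk_word_cons IH /= eqxx gtn_eqF.
have act1' k pt : act i.+1 (nseq k (i.+1, false)) pt = walk1 k pt.
  rewrite -foldl_walk1 /act; congr foldl; elim: k => //= k IH.
  by rewrite sub_walk_word_cons IH /= eqxx.
rewrite !seg act2 act1' /north /walk1 /=.
have : nth 0 lam i = 0 /\ nth 0 lam i.+1 = 0 \/ nth 0 lam i.+1 < nth 0 lam i.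
  case: (ltnP i (size lam)) => hi; last by left; rewrite !nth_default // ltnW.
  by right; apply: (strict_nth sR hi).2.
by case: ifP => [/eqP|] h0 /=; lia.
Qed.

(** Values increase strictly along the diagonal, starting from at least 1, and weakly along each
    row. *)
Lemma straight_val_ge r c : inshape (outer R) r c -> r.+1 <= (ent R r c).1.
Proof.
have diag k : inskew R k k -> k.+1 <= (ent R k k).1.
  elim: k => [|k IH] p; first exact: (good_valid gR p).
  have p' : inskew R k k.
    by move: p; rewrite !inskewE => h; apply: (inshape_ideal sR h).
  by apply: leq_ltn_trans (IH p') (good_diag_lt gR p' p _).
rewrite -inskewE => p.
have le : r <= c by move: p; rewrite inskewE inshapeE; lia.
have p' : inskew R r r.
  by move: p; rewrite !inskewE => h; apply: (inshape_ideal sR h).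
apply: (leq_trans (diag r p')); case: (eqVneq r c) => [->//|ne].
have := good_row gR p' p; rewrite /rowlt; lia.
Qed.

Lemma act_snd_gt0 i u pt : (forall x : letter, x \in u -> x.1 != i) -> 0 < pt.2 ->
  0 < (act i u pt).2.
Proof.
elim: u pt => // x u IH pt h p; rewrite act_cons; apply: IH => [y yu|].
  by apply: h; rewrite inE yu orbT.
rewrite act1 (negPf (h x _)) ?inE ?eqxx //; case: ifP => // _.
by case: pt p => [[|a] [|b]] //=; case: (x.2).
Qed.

Lemma straight_walk_ballot :
  (forall i, 0 < i -> (act i (reading R) (0, 0)).2 = 0) ->
  forall r c, inshape (outer R) r c -> ent R r c = (r.+1, false).
Proof.
move=> walk0.
have val j : forall r c, inskew R r c -> (ent R r c).1 = j -> j = r.+1.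
  elim/ltn_ind: j => j IH r c p ej; apply/eqP; apply: contraT => nj.
  have pL : inshape (outer R) r c by rewrite -inskewE.
  have ge := straight_val_ge pL; rewrite ej in ge.
  have lt : r.+1 < j by lia.
  have [rN cM] := strict_bound sR pL.
  have := walk0 j.-1; rewrite (reading_rd sR (strict_bound sR)).
  rewrite (rd_split _ _ _ rN) (rowseg_split _ _ _ cM) p.
  rewrite -[(_ ++ _ :: _) ++ _]catA catA act_cat cat_cons act_cons => h.
  suff : 0 < (act j.-1 (rowseg (inskew R) (ent R) (iota c.+1 (nth 0 (outer R) 0 - c.+1)) r ++
     rows (nth 0 (outer R) 0) (inskew R) (ent R) (iota 0 r))
     (act j.-1 [:: ent R r c] (act j.-1 (rows (nth 0 (outer R) 0) (inskew R) (ent R)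
         (iota r.+1 (size (outer R) - r.+1)) ++
       rowseg (inskew R) (ent R) (iota 0 c) r) (0, 0)))).2.
    by rewrite h //; lia.
  apply: act_snd_gt0 => [x|]; last first.
    (* A letter of value j leaves the walk at positive height: it steps north, or west from a point
       with y > 0. *)
    rewrite act1 ej; have -> : (j == j.-1) = false by lia.
    rewrite (_ : j == j.-1.+1) ?prednK ?eqxx //; last by lia.
    by case: (act _ _ _) (ent R r c).2 => [[|a] [|b]] [|].
  rewrite mem_cat => /orP[/mapP[c']|/mem_rows[r' [c' [r's p' ->]]]].
    rewrite mem_filter mem_iota => /andP[p' h'] ->.
    have lt' : c < c' by lia.
    by have := good_row gR p p' lt'; rewrite /rowlt ej; lia.
  (* By induction the value j - 1 occurs only in the row of index j - 2, which is at least r,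
     whereas r' < r. *)
  rewrite mem_iota in r's; apply/eqP => e.
  have := IH j.-1 _ _ _ p' e; lia.
move=> r c p; have e1 := p; rewrite -inskewE in e1.
have e := val _ _ _ e1 erefl.
have le : r <= c by move: p; rewrite inshapeE; lia.
have p' : inskew R r r by rewrite inskewE; apply: (inshape_ideal sR p).
rewrite [ent R r c]surjective_pairing e; congr pair.
case: (eqVneq r c) => [ec|ne]; first by rewrite -ec; apply: (good_diag gR p').
have lt : r < c by lia.
have := good_row gR p' e1 lt; rewrite /rowlt e (val _ _ _ p' erefl) ltnn eqxx /=.
by case: (_.2).
Qed.

End Straight.

Theorem mainTheorem2 (n : nat) (w : seq letter) :
  all (fun a => (1 <= a.1 <= n)%N) w ->
  (ballot w <-> forall i, (1 <= i <= n.-1)%N -> (ith_walk_end i w).2 = 0%N).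
Proof.
move=> hw; have pos : all valid_letter (canon w).
  by apply: canon_valid; apply: sub_all hw => x /andP[].
split=> [bal i /andP[i1 _]|walk T R sst rdT rect].
  have [T [sst rdT]] := antidiagonal_tableau pos.
  have okT := semistandard_ok sst rdT.
  have [R rect] := rectifies_exists okT.
  have [okR inR eR] := rectifies_ok rect okT.
  rewrite -[ith_walk_end i w]/(act i w (0, 0)) -act_canon -rdT -eR.
  by apply: straight_ballot_walk => // r c; apply: (bal T R).
have okT := semistandard_ok sst rdT.
have [okR inR eR] := rectifies_ok rect okT.
apply: straight_walk_ballot => // i i1; rewrite eR rdT act_canon.
case: (leqP i n.-1) => h; first by apply: walk; rewrite i1.
(* For i >= n no letter of value i+1 occurs in the word, so the walk never leaves the x-axis. *)
apply: act_snd0 => // x /(allP hw); lia.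
Qed.
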